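(* Fix $x_0>0$ and let $\gamma^{\rho,x_0}$ be the chordal $\mathrm{SLE}_0(\rho)$ in $\mathbb H$ from $0$, with reference point $\infty$ and force point $x_0$. Then: (i) If $\rho\in(-\infty,-4]$, then $\gamma^{\rho,x_0}(\tau)=x_0$ and the (outer) hitting angle is $\alpha\pi=\pi\frac{4+\rho}{2+\rho}$. Moreover the hitting time is $\tau=-\frac{x_0^2}{2(2+\rho)}$. (ii) If $\rho\in(-4,-2)$, then $\gamma^{\rho,x_0}(\tau)=-\frac{2}{\rho+2}x_0>x_0$ and the (outer) hitting angle is $\alpha\pi=\pi\frac{4+\rho}{2}$. Moreover the hitting time is $\tau=-\frac{x_0^2}{2(2+\rho)}$. (iii) If $\rho=-2$, then $\gamma^{\rho,x_0}$ approaches $\infty$ asymptotic to $\{x+i\pi x_0:x\in\mathbb R^+\}$. (iv) If $\rho\in(-2,\infty)$, then $\gamma^{\rho,x_0}$ approaches $\infty$ at an angle $\alpha\pi=\pi\frac{2+\rho}{4+\rho}$.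
   Context: $\mathbb H$ is the upper half-plane. The chordal $\mathrm{SLE}_0(\rho)$ from $0$ with reference point $\infty$ and force point $x_0$ is the curve whose (half-plane capacity) driving function solves $\dot W_t=\frac{\rho}{W_t-x_t}$, $W_0=0$, with $x_t=g_t(x_0)$, $\partial_tg_t(z)=\frac2{g_t(z)-W_t}$, $g_0(z)=z$, and $\gamma(t)=\lim_{y\to0+}g_t^{-1}(W_t+iy)$, run up to $\tau_{0+}=\lim_{\varepsilon\to0+}\inf\{t:|W_t-x_t|=\varepsilon\}$. In (i) and (ii), $\tau=\tau_{0+}$ is the time at which the curve terminates on the real line, and $\gamma(\tau)$ is the limit of $\gamma(t)$ as $t\to\tau-$. The outer hitting angle is the angle at $\gamma(\tau)$ between the curve and the half-line $[\gamma(\tau),\infty)$, measured in the unbounded component of $\mathbb H\setminus\gamma$. In (iv), approaching $\infty$ at an angle $\alpha\pi$ means $\gamma(t)\to\infty$ with $\arg\gamma(t)\to\alpha\pi$. *)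

(* Defs.v *)
(* Stdlib reals with Coquelicot. *)
From Stdlib Require Import Reals Ratan.
From Coquelicot Require Import Coquelicot.

Open Scope R_scope.

(* Filter of "t -> T-"; for [T = p_infty] this is t -> +oo. *)
Definition Rbar_at_left (T : Rbar) : (R -> Prop) -> Prop :=
  within (fun t : R => Rbar_lt t T) (Rbar_locally T).

(* Convergence in the order topology of the extended reals (Coquelicot puts no
   topology on [Rbar] as a target space). *)
Definition is_Rbar_limit (F : (R -> Prop) -> Prop) (h : R -> Rbar) (l : Rbar)
    : Prop :=
  (forall a : R, Rbar_lt a l -> F (fun e => Rbar_lt a (h e))) /\
  (forall b : R, Rbar_lt l b -> F (fun e => Rbar_lt (h e) b)).

(* Principal argument, in (-PI, PI], for [z <> 0]. *)
Definition Carg (z : C) : R :=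
  if Rle_dec 0 (Im z) then acos (Re z / Cmod z) else - acos (Re z / Cmod z).

Definition upper_half_plane (z : C) : Prop := 0 < Im z.

(* [u] solves u' = 2 / (u - W), u(0) = z, on the whole interval [0, t]; at the
   endpoints of the interval, continuity makes the one-sided equation hold. *)
Definition loewner_solution (W : R -> R) (z : C) (t : R) (u : R -> C)
    : Prop :=
  u 0 = z /\
  (forall s, 0 <= s <= t -> u s <> RtoC (W s)) /\
  (forall s, 0 <= s <= t ->
     filterlim u (within (fun r => 0 <= r <= t) (locally s)) (locally (u s))) /\
  (forall s, 0 < s < t ->
     @is_derive R_AbsRing C_R_NormedModule u s (2 / (u s - W s))%C).

(* The points whose Loewner flow line survives up to and including time t. *)
Definition loewner_domain (W : R -> R) (t : R) (z : C) : Prop :=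
  exists u : R -> C, loewner_solution W z t u.

(* The complement H \ K_t of the hull. *)
Definition hull_complement (W : R -> R) (t : R) (z : C) : Prop :=
  upper_half_plane z /\ loewner_domain W t z.

Definition is_loewner_flow (W : R -> R) (T : Rbar) (g : R -> C -> C)
    : Prop :=
  forall (t : R) (z : C), 0 <= t -> Rbar_lt t T -> loewner_domain W t z ->
    loewner_solution W z t (fun s => g s z).

(* [ginv t] is the inverse of the conformal bijection g_t : H \ K_t -> H. *)
Definition is_inverse_flow (W : R -> R) (T : Rbar) (g ginv : R -> C -> C)
    : Prop :=
  forall t : R, 0 <= t -> Rbar_lt t T ->
    (forall z, hull_complement W t z -> ginv t (g t z) = z) /\
    (forall w, upper_half_plane w ->
       hull_complement W t (ginv t w) /\ g t (ginv t w) = w).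

Definition is_loewner_trace (W : R -> R) (T : Rbar) (ginv : R -> C -> C)
    (gamma : R -> C) : Prop :=
  forall t : R, 0 <= t -> Rbar_lt t T ->
    filterlim (fun y : R => ginv t (W t + Ci * y)%C) (at_right 0)
              (locally (gamma t)).

(* inf {t in [0, T) : |W_t - x_t| = eps}, equal to +oo when there is no such t. *)
Definition hitting_time (T : Rbar) (W x : R -> R) (eps : R) : Rbar :=
  Glb_Rbar (fun t => 0 <= t /\ Rbar_lt t T /\ Rabs (W t - x t) = eps).

(* [gamma] on [0, tau) is the chordal SLE_0(rho) in H from 0 to oo with force
   point x0.  W and x are only constrained on [0, tau).  The last clause says
   tau = tau_{0+}; it also forces [0, tau) to be the maximal interval, since on
   a shorter one |W - x| would stay away from 0 and the limit would be +oo. *)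
Record is_SLE0_rho (rho x0 : R) (tau : Rbar) (W x : R -> R)
    (g ginv : R -> C -> C) (gamma : R -> C) : Prop := {
  sle_driving_start : W 0 = 0;
  sle_driving_cont0 : filterlim W (at_right 0) (locally (W 0));
  sle_driving_ode : forall t, 0 < t -> Rbar_lt t tau ->
    is_derive W t (rho / (W t - x t));
  sle_flow : is_loewner_flow W tau g;
  sle_force_point : forall t, 0 <= t -> Rbar_lt t tau ->
    loewner_domain W t (RtoC x0) /\ g t (RtoC x0) = RtoC (x t);
  sle_inverse : is_inverse_flow W tau g ginv;
  sle_trace : is_loewner_trace W tau ginv gamma;
  sle_lifetime : is_Rbar_limit (at_right 0) (hitting_time tau W x) tau
}.

Definition connected_set (S : C -> Prop) : Prop :=
  forall U V : C -> Prop, open U -> open V ->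
    (forall z, S z -> U z \/ V z) ->
    (exists z, S z /\ U z) -> (exists z, S z /\ V z) ->
    exists z, S z /\ U z /\ V z.

Definition unbounded_set (S : C -> Prop) : Prop :=
  forall M : R, exists z, S z /\ M < Cmod z.

(* z lies in an unbounded connected component of A. *)
Definition in_unbounded_component (A : C -> Prop) (z : C) : Prop :=
  exists S : C -> Prop,
    connected_set S /\ (forall w, S w -> A w) /\ S z /\ unbounded_set S.

Definition curve_complement (T : Rbar) (gamma : R -> C) (z : C) : Prop :=
  upper_half_plane z /\
  ~ (exists t, 0 <= t /\ Rbar_lt t T /\ gamma t = z).

(* gamma(t) tends, as t -> T-, to the real point p in the direction theta
   (counterclockwise from the half-line [p, +oo)), and the sector at p swept
   between that half-line and the curve lies in the unbounded component of the
   complement of the curve in H. *)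
Definition outer_hitting_angle (T : Rbar) (gamma : R -> C) (p theta : R)
    : Prop :=
  filterlim (fun t => Carg (gamma t - p)%C) (Rbar_at_left T) (locally theta) /\
  (forall eps, 0 < eps -> exists r, 0 < r /\
     forall s phi, 0 < s < r -> 0 < phi < theta - eps ->
       in_unbounded_component (curve_complement T gamma)
         (p + s * (cos phi + Ci * sin phi))%C).

Definition tends_to_infinity (T : Rbar) (gamma : R -> C) : Prop :=
  filterlim (fun t => Cmod (gamma t)) (Rbar_at_left T) (Rbar_locally p_infty).

Definition approaches_infinity_at_angle (T : Rbar) (gamma : R -> C)
    (theta : R) : Prop :=
  tends_to_infinity T gamma /\
  filterlim (fun t => Carg (gamma t)) (Rbar_at_left T) (locally theta).

Definition approaches_infinity_asymptotic_to (T : Rbar) (gamma : R -> C)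
    (L : C -> Prop) : Prop :=
  tends_to_infinity T gamma /\
  (forall eps, 0 < eps ->
     Rbar_at_left T (fun t => exists l, L l /\ Cmod (gamma t - l)%C < eps)).

(* Main.v *)
Require Import Defs.
From Stdlib Require Import Reals Ratan Lra.
From Coquelicot Require Import Coquelicot.
Open Scope R_scope.

(** Let D = x - W be the gap between the force point and the driving function, and
    e = (rho + 2) / 2. The two driving equations give D' = 2 e / D, hence
    D^2 = x0^2 + 4 e t: the gap closes exactly at time - x0^2 / (4 e) if e < 0, and
    never if e >= 0 ([SLE0_lifetime]).

    The curve itself is not computed from the inverse maps but from a conserved
    quantity. Along the Loewner flow, with Y = g_t(z) - x_t, the expression
    g_t'(z) (g_t(z) - W_t) Y^(rho/2) does not depend on t, and neither does its
    primitive in z, which up to a constant factor is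

      Y^e (Y + (1 + 1/e) D) = (g_t(z) - x_t)^e (g_t(z) - W_t + D/e)

    ([log_invariant]). Initially it is (z - x0)^e (z - p) with p = - x0 / e. The tip
    gamma(t) is the limit of the points z with g_t(z) = W_t + i y as y tends to 0,
    where Y tends to -D, so the curve satisfies the implicit equation

      (gamma - x0)^e (gamma - p) = (-D)^e D / e

    ([trace_equation]). Taking logarithms of moduli and arguments in the upper
    half-plane splits it into two real equations; the second one,

      e Arg(gamma - x0) + Arg(gamma - p) = e PI + Arg(D / e),

    does not involve time, for D > 0. The exponents e = 0 and
    e = -1, that is rho = -2 and rho = -4, are those for which the primitive contains
    a logarithm; there the same argument gives the equations of
    [trace_equation_marginal] and [trace_equation_tangential].

    The theorem is the asymptotic analysis of these equations. If e < -1, the modulus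
    equation sends gamma to x0 as D tends to 0, the argument of gamma - p tends to 0,
    and the argument equation gives the angle. If -1 < e < 0, gamma tends to p instead
    and the two arguments exchange roles. If e > 0, D tends to infinity, gamma does
    too, and the two arguments have the same limit. For rho = -4 and rho = -2 one reads
    the tangential approach and the asymptotic line off the degenerate equations.

    That the sector outside the curve lies in the unbounded component is also a
    consequence of the argument equation: along a ray from the hitting point with
    direction smaller than the hitting angle, one of the two arguments is constant and
    the other has a sign that makes the equation impossible. The whole ray thus avoids
    the curve and joins its points to infinity. *)

(** * Limits along a filter *)

Lemma lim_plus {T} (F : (T -> Prop) -> Prop) {FF : Filter F} (f g : T -> R) (a b : R) :
  filterlim f F (locally a) -> filterlim g F (locally b) ->
  filterlim (fun s => f s + g s) F (locally (a + b)).
Proof.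
  intros Hf Hg.
  exact (filterlim_comp_2 f g plus Hf Hg (filterlim_plus (V := R_NormedModule) a b)).
Qed.

Lemma lim_mult {T} (F : (T -> Prop) -> Prop) {FF : Filter F} (f g : T -> R) (a b : R) :
  filterlim f F (locally a) -> filterlim g F (locally b) ->
  filterlim (fun s => f s * g s) F (locally (a * b)).
Proof.
  intros Hf Hg.
  exact (filterlim_comp_2 f g mult Hf Hg (filterlim_mult (K := R_AbsRing) a b)).
Qed.

Lemma lim_comp {T} (F : (T -> Prop) -> Prop) (h : R -> R) (f : T -> R) (a : R) :
  continuity_pt h a -> filterlim f F (locally a) ->
  filterlim (fun s => h (f s)) F (locally (h a)).
Proof.
  intros Hh Hf. apply filterlim_comp with (1 := Hf).
  now apply continuity_pt_filterlim.
Qed.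

Lemma lim_opp {T} (F : (T -> Prop) -> Prop) (f : T -> R) (a : R) :
  filterlim f F (locally a) -> filterlim (fun s => - f s) F (locally (- a)).
Proof.
  apply (lim_comp F Ropp). apply continuity_pt_opp, derivable_continuous_pt, derivable_pt_id.
Qed.

Lemma lim_minus {T} (F : (T -> Prop) -> Prop) {FF : Filter F} (f g : T -> R) (a b : R) :
  filterlim f F (locally a) -> filterlim g F (locally b) ->
  filterlim (fun s => f s - g s) F (locally (a - b)).
Proof.
  intros Hf Hg. apply lim_plus; trivial. now apply lim_opp.
Qed.

Lemma lim_inv {T} (F : (T -> Prop) -> Prop) (f : T -> R) (a : R) :
  a <> 0 -> filterlim f F (locally a) -> filterlim (fun s => / f s) F (locally (/ a)).
Proof.
  intros Ha. apply (lim_comp F Rinv).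
  apply (continuity_pt_inv id); trivial.
  apply derivable_continuous_pt, derivable_pt_id.
Qed.

Lemma lim_div {T} (F : (T -> Prop) -> Prop) {FF : Filter F} (f g : T -> R) (a b : R) :
  b <> 0 -> filterlim f F (locally a) -> filterlim g F (locally b) ->
  filterlim (fun s => f s / g s) F (locally (a / b)).
Proof.
  intros Hb Hf Hg. apply lim_mult; trivial. now apply lim_inv.
Qed.

Lemma lim_ln {T} (F : (T -> Prop) -> Prop) (f : T -> R) (a : R) :
  0 < a -> filterlim f F (locally a) -> filterlim (fun s => ln (f s)) F (locally (ln a)).
Proof.
  intros Ha. apply lim_comp. apply derivable_continuous_pt.
  exists (/ a). now apply derivable_pt_lim_ln.
Qed.

Lemma lim_exp {T} (F : (T -> Prop) -> Prop) (f : T -> R) (a : R) :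
  filterlim f F (locally a) -> filterlim (fun s => exp (f s)) F (locally (exp a)).
Proof.
  apply lim_comp. apply derivable_continuous_pt, derivable_pt_exp.
Qed.

Lemma lim_unique {T} (F : (T -> Prop) -> Prop) {FF : ProperFilter F} (f : T -> R) (a b : R) :
  filterlim f F (locally a) -> filterlim f F (locally b) -> a = b.
Proof.
  intros Ha Hb. exact (filterlim_locally_unique (V:=R_NormedModule) f a b Ha Hb).
Qed.

Lemma lim_ge {T} (F : (T -> Prop) -> Prop) {FF : ProperFilter F} (f : T -> R) (c l : R) :
  F (fun s => c <= f s) -> filterlim f F (locally l) -> c <= l.
Proof.
  intros Hc Hl. destruct (Rle_lt_dec c l) as [H | H]; trivial. exfalso.
  assert (He : F (fun s => f s < c)) by exact (Hl _ (open_lt c l H)).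
  destruct (filter_ex _ (filter_and _ _ Hc He)) as [s Hs]. lra.
Qed.

Lemma lim_bounded {T} (F : (T -> Prop) -> Prop) {FF : Filter F} (f : T -> R) (l : R) :
  filterlim f F (locally l) -> F (fun s => Rabs (f s) <= Rabs l + 1).
Proof.
  intros Hl. generalize (proj1 (filterlim_locally f l) Hl (mkposreal 1 Rlt_0_1)).
  apply filter_imp. intros s Hs. change (Rabs (f s - l) < 1) in Hs.
  pose proof (Rabs_triang_inv (f s) l). lra.
Qed.

Lemma lim_pair {T} (F : (T -> Prop) -> Prop) {FF : Filter F} (p q : T -> R) (a b : R) :
  filterlim p F (locally a) -> filterlim q F (locally b) ->
  filterlim (fun s => (p s, q s) : C) F (locally ((a, b) : C)).
Proof.
  intros Hp Hq. apply filterlim_locally. intros eps.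
  apply filter_and; [ apply (proj1 (filterlim_locally p a) Hp eps)
                    | apply (proj1 (filterlim_locally q b) Hq eps) ].
Qed.

Lemma lim_Re {T} (F : (T -> Prop) -> Prop) {FF : Filter F} (f : T -> C) (z : C) :
  filterlim f F (locally z) -> filterlim (fun s => Re (f s)) F (locally (Re z)).
Proof.
  intros H. apply filterlim_locally. intros eps.
  generalize (proj1 (filterlim_locally f z) H eps). apply filter_imp.
  intros s Hs; apply Hs.
Qed.

Lemma lim_Im {T} (F : (T -> Prop) -> Prop) {FF : Filter F} (f : T -> C) (z : C) :
  filterlim f F (locally z) -> filterlim (fun s => Im (f s)) F (locally (Im z)).
Proof.
  intros H. apply filterlim_locally. intros eps.
  generalize (proj1 (filterlim_locally f z) H eps). apply filter_imp.
  intros s Hs; apply Hs.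
Qed.

Lemma is_derive_Re (u : R -> C) (s : R) (l : C) :
  @is_derive R_AbsRing C_R_NormedModule u s l -> is_derive (fun r => Re (u r)) s (Re l).
Proof.
  intros H.
  apply (filterdiff_comp' u (fun z : C_R_NormedModule => fst z) s
     (fun y => scal y l) (fun z => fst z) H).
  apply filterdiff_linear. apply is_linear_fst.
Qed.

Lemma is_derive_Im (u : R -> C) (s : R) (l : C) :
  @is_derive R_AbsRing C_R_NormedModule u s l -> is_derive (fun r => Im (u r)) s (Im l).
Proof.
  intros H.
  apply (filterdiff_comp' u (fun z : C_R_NormedModule => snd z) s
     (fun y => scal y l) (fun z => snd z) H).
  apply filterdiff_linear. apply is_linear_snd.
Qed.

Lemma at_right_pos : at_right 0 (fun y => 0 < y).
Proof. exists (mkposreal 1 Rlt_0_1). intros y _ Hy. exact Hy. Qed.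

Lemma lim_at_right : filterlim (fun y : R => y) (at_right 0) (locally 0).
Proof. intros P HP. unfold filtermap, at_right, within. revert HP. now apply filter_imp. Qed.

(** * Functions continuous on a time segment *)

(** The form of continuity that Loewner solutions provide: one-sided at the two
    ends of the time interval. *)
Definition continuous_on_segment (T : R) (f : R -> R) : Prop :=
  forall s, 0 <= s <= T ->
    filterlim f (within (fun r => 0 <= r <= T) (locally s)) (locally (f s)).

(** Freezing the function outside the segment turns the one-sided continuity at
    the endpoints into continuity on the line, where the mean value and
    intermediate value theorems apply. *)
Lemma segment_extension (f : R -> R) (T : R) :
  0 <= T -> continuous_on_segment T f ->
  exists h : R -> R, (forall s, 0 <= s <= T -> h s = f s) /\ forall s, continuity_pt h s.
Proof.
  intros HT Hc.
  set (k := fun s => Rmax 0 (Rmin s T)).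
  assert (Hk : forall s, 0 <= s <= T -> k s = s).
  { intros s Hs. unfold k. rewrite Rmin_left, Rmax_right; lra. }
  assert (Hk' : forall s, 0 <= k s <= T).
  { intros s. unfold k. split. apply Rmax_l. apply Rmax_lub. lra. apply Rmin_r. }
  exists (fun s => f (k s)). split.
  - intros s Hs. now rewrite Hk.
  - intros s. apply continuity_pt_filterlim.
    eapply filterlim_comp. 2: apply Hc, Hk'.
    intros P [d HP]. exists d. intros r Hr.
    apply HP; [ | apply Hk' ].
    apply Rle_lt_trans with (2 := Hr).
    change (Rabs (k r - k s) <= Rabs (r - s)).
    unfold k, Rmax, Rmin. repeat destruct Rle_dec;
    unfold Rabs; repeat destruct Rcase_abs; lra.
Qed.

Lemma MVT_segment (f df : R -> R) (T a b : R) :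
  0 <= a -> a <= b -> b <= T -> continuous_on_segment T f ->
  (forall s, 0 < s < T -> is_derive f s (df s)) ->
  exists c, f b - f a = df c * (b - a).
Proof.
  intros Ha Hab Hb Hc Hd.
  destruct (segment_extension f T) as [h [Hh Hcont]]; [ lra | trivial | ].
  destruct (MVT_gen h a b df) as [c [_ E]]; trivial.
  - rewrite Rmin_left, Rmax_right by lra. intros c Hcc.
    apply is_derive_ext_loc with f. 2: apply Hd; lra.
    assert (Hr : locally c (fun r => a < r < b)).
    { apply (locally_interval _ c a b); simpl; tauto. }
    revert Hr. apply filter_imp. intros r Hr. rewrite Hh; lra.
  - exists c. rewrite (Hh a), (Hh b) in E by lra. exact E.
Qed.

Lemma segment_constant (f : R -> R) (T : R) :
  0 <= T -> continuous_on_segment T f -> (forall s, 0 < s < T -> is_derive f s 0) ->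
  forall s, 0 <= s <= T -> f s = f 0.
Proof.
  intros HT Hc Hd s Hs.
  destruct (MVT_segment f (fun _ => 0) T 0 s) as [c E]; trivial; lra.
Qed.

Lemma segment_same_sign (f : R -> R) (T a b : R) :
  continuous_on_segment T f -> (forall s, 0 <= s <= T -> f s <> 0) ->
  0 <= a <= T -> 0 <= b <= T -> 0 < f a -> 0 < f b.
Proof.
  intros Hc Hn Ha Hb Hp.
  destruct (segment_extension f T) as [h [Hh Hcont]]; [ lra | trivial | ].
  destruct (Rlt_le_dec 0 (f b)) as [H | H]; trivial. exfalso.
  destruct (IVT_gen h a b 0 Hcont) as [c [Hc1 Hc2]].
  - rewrite !Hh by lra. rewrite Rmin_right, Rmax_left by lra. lra.
  - pose proof (Rmin_glb a b 0 ltac:(lra) ltac:(lra)).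
    pose proof (Rmax_lub a b T ltac:(lra) ltac:(lra)).
    rewrite Hh in Hc2 by lra. apply (Hn c); lra.
Qed.

(** * Modulus and argument in the closed upper half-plane *)

Lemma sum_sq_neq_0 (a b : R) : b <> 0 -> a * a + b * b <> 0.
Proof.
  intros Hb. pose proof (Rle_0_sqr a) as Ha. apply Rsqr_pos_lt in Hb. unfold Rsqr in *. lra.
Qed.

Lemma ln_lt_self (y : R) : 0 < y -> ln y < y.
Proof. intros Hy. pose proof (exp_ineq1_le (ln y)) as H. rewrite exp_ln in H; lra. Qed.

Lemma Cmod_sq (p q : R) : Cmod (p, q) * Cmod (p, q) = p * p + q * q.
Proof.
  unfold Cmod; simpl. rewrite sqrt_sqrt; nra.
Qed.

Lemma Cmod_pos (p q : R) : (p, q) <> RtoC 0 -> 0 < Cmod (p, q).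
Proof. intros H. now apply Cmod_gt_0. Qed.

Lemma Cmod_pos_Im (p q : R) : 0 < q -> 0 < Cmod (p, q).
Proof. intros H. apply Cmod_pos. intros E. injection E. lra. Qed.

Lemma Cmod_neg_real (d : R) : 0 < d -> Cmod (- d, 0) = d.
Proof.
  intros Hd. change (- d, 0) with (RtoC (- d)). rewrite Cmod_R, Rabs_Ropp. apply Rabs_pos_eq. lra.
Qed.

Lemma Re_le_Cmod (p q : R) : Rabs p <= Cmod (p, q).
Proof.
  apply Rsqr_incr_0_var; [ | apply Cmod_ge_0 ].
  rewrite <- Rsqr_abs. unfold Rsqr. rewrite Cmod_sq. nra.
Qed.

Lemma Im_le_Cmod (p q : R) : Rabs q <= Cmod (p, q).
Proof.
  apply Rsqr_incr_0_var; [ | apply Cmod_ge_0 ].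
  rewrite <- Rsqr_abs. unfold Rsqr. rewrite Cmod_sq. nra.
Qed.

Lemma Cmod_le_sum (p q : R) : Cmod (p, q) <= Rabs p + Rabs q.
Proof.
  pose proof (Rabs_pos p); pose proof (Rabs_pos q).
  apply Rsqr_incr_0_var; [ | lra ].
  unfold Rsqr. rewrite Cmod_sq.
  pose proof (Rsqr_abs p) as E1. pose proof (Rsqr_abs q) as E2. unfold Rsqr in *. nra.
Qed.

Lemma Cmod_shift (p q c : R) : Cmod (p + c, q) <= Cmod (p, q) + Rabs c.
Proof.
  replace ((p + c, q) : C) with (Cplus (p, q) (RtoC c)).
  - rewrite <- Cmod_R. apply Cmod_triangle.
  - unfold Cplus, RtoC; simpl. f_equal; ring.
Qed.

Lemma lim_Cmod {T} (F : (T -> Prop) -> Prop) {FF : Filter F} (p q : T -> R) (a b : R) :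
  filterlim p F (locally a) -> filterlim q F (locally b) ->
  filterlim (fun s => Cmod (p s, q s)) F (locally (Cmod (a, b))).
Proof.
  intros Hp Hq. unfold Cmod; simpl.
  apply (lim_comp F sqrt (fun s => p s * (p s * 1) + q s * (q s * 1))).
  - apply continuity_pt_sqrt. nra.
  - rewrite !Rmult_1_r.
    apply filterlim_ext with (fun s => p s * p s + q s * q s). intros; ring.
    apply lim_plus; trivial; apply lim_mult; trivial.
Qed.

Lemma Carg_acos (p q : R) : 0 <= q -> Carg (p, q) = acos (p / Cmod (p, q)).
Proof.
  intros Hq. unfold Carg. simpl. destruct Rle_dec; [ reflexivity | contradiction ].
Qed.

Lemma Carg_bounds (p q : R) : 0 <= q -> 0 <= Carg (p, q) <= PI.
Proof. intros Hq. rewrite Carg_acos by trivial. apply acos_bound. Qed.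

Lemma cos_Carg_range (p q : R) : 0 < Cmod (p, q) -> -1 <= p / Cmod (p, q) <= 1.
Proof.
  intros H. pose proof (Re_le_Cmod p q) as H1. apply Rabs_le_between in H1.
  split; [ apply Rle_div_r | apply Rle_div_l ]; lra.
Qed.

Lemma cos_Carg (p q : R) : 0 <= q -> 0 < Cmod (p, q) -> cos (Carg (p, q)) = p / Cmod (p, q).
Proof.
  intros Hq H. rewrite Carg_acos by trivial. apply cos_acos, cos_Carg_range, H.
Qed.

Lemma Carg_pos_real (d : R) : 0 < d -> Carg (d, 0) = 0.
Proof.
  intros Hd. rewrite Carg_acos by lra. change (d, 0) with (RtoC d).
  rewrite Cmod_R, Rabs_pos_eq by lra.
  replace (d / d) with 1 by (field; lra). apply acos_1.
Qed.

Lemma Carg_neg_real (d : R) : 0 < d -> Carg (- d, 0) = PI.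
Proof.
  intros Hd. rewrite Carg_acos by lra. change (- d, 0) with (RtoC (- d)).
  rewrite Cmod_R, Rabs_Ropp, Rabs_pos_eq by lra.
  replace (- d / d) with (- (1)) by (field; lra). rewrite acos_opp, acos_1. ring.
Qed.

Lemma Carg_polar (r phi : R) : 0 < r -> 0 < phi < PI ->
  Carg (r * cos phi, r * sin phi) = phi.
Proof.
  intros Hr Hphi. assert (Hs := sin_gt_0 phi (proj1 Hphi) (proj2 Hphi)).
  rewrite Carg_acos by nra.
  replace (Cmod (r * cos phi, r * sin phi)) with r.
  - replace (r * cos phi / r) with (cos phi) by (field; lra). apply acos_cos; lra.
  - unfold Cmod; simpl. symmetry. apply sqrt_lem_1; try nra.
    pose proof (sin2_cos2 phi) as H. unfold Rsqr in H. nra.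
Qed.

(** In the open half-plane the argument is a smooth function of the slope; the
    arccosine form is kept because it is continuous up to the real line. *)
Lemma Carg_atan (p q : R) : 0 < q -> Carg (p, q) = PI / 2 - atan (p / q).
Proof.
  intros Hq. rewrite Carg_acos by lra.
  pose proof (Cmod_pos_Im p q Hq) as Hm. pose proof (Cmod_sq p q) as Hs.
  set (m := Cmod (p, q)) in *.
  assert (H1 : -1 < p / m < 1).
  { split; [ apply Rlt_div_r | apply Rlt_div_l ]; nra. }
  rewrite acos_asin, asin_atan by lra. do 2 f_equal.
  replace (1 - (p / m)²) with ((q / m)²).
  2:{ unfold Rsqr. apply Rmult_eq_reg_r with (m * m). 2: nra.
      transitivity (q * q); [ field; lra | ].
      replace (q * q) with (m * m - p * p) by lra. field. lra. }
  rewrite sqrt_Rsqr. field. lra. apply Rlt_le, Rdiv_lt_0_compat; lra.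
Qed.

Lemma Carg_shift (p q c : R) : 0 <= q -> 0 <= c -> 0 < Cmod (p, q) -> 0 < Cmod (p + c, q) ->
  Carg (p + c, q) <= Carg (p, q).
Proof.
  intros Hq Hc H1 H2.
  destruct (Rle_lt_or_eq_dec 0 q Hq) as [Hq' | <-].
  - rewrite !Carg_atan by trivial.
    assert (p / q <= (p + c) / q).
    { apply Rmult_le_compat_r. apply Rlt_le, Rinv_0_lt_compat, Hq'. lra. }
    destruct H as [H | ->]; [ | lra ]. apply atan_increasing in H. lra.
  - rewrite !Carg_acos in * by lra.
    assert (E : forall x, Cmod (x, 0) = Rabs x) by (intros; apply Cmod_R).
    rewrite !E in *.
    assert (E' : forall x, 0 < Rabs x -> x / Rabs x = 1 /\ 0 < x \/ x / Rabs x = -1 /\ x < 0).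
    { clear. intros x Hx. unfold Rabs in *. destruct (Rcase_abs x); [right | left]; split; try lra; field; lra. }
    destruct (E' _ H1) as [[-> H3] | [-> H3]]; destruct (E' _ H2) as [[-> H4] | [-> H4]]; try lra.
    rewrite acos_1. apply acos_bound.
Qed.

(** The endpoints, where the arccosine is not differentiable, matter: they are
    the arguments 0 and PI of real points. Near 1 one uses
    [acos x = atan (sqrt (1 - x^2) / x)], and near -1 the symmetry. *)
Lemma continuity_acos (x : R) : -1 <= x <= 1 -> continuity_pt acos x.
Proof.
  intros Hx.
  assert (Hpos : forall x, 0 < x -> continuity_pt acos x).
  { clear. intros x Hx. apply continuity_pt_filterlim.
    apply filterlim_ext_loc with (fun y => atan (sqrt (1 - Rsqr y) / y)).
    - assert (H : locally x (fun y => 0 < y)) by now apply (open_gt 0 x).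
      revert H. apply filter_imp. intros y Hy. symmetry. now apply acos_atan.
    - rewrite acos_atan by trivial.
      apply (lim_comp _ atan). apply derivable_continuous_pt, derivable_pt_atan.
      assert (FF : Filter (locally x)) by apply filter_filter.
      apply lim_div; trivial; [ lra | | apply filterlim_id ].
      unfold Rsqr.
      apply (filterlim_comp _ _ _ (fun y => 1 - y * y) sqrt _ (locally (1 - x * x))).
      + apply lim_minus; trivial; [ apply filterlim_const | ].
        apply lim_mult; trivial; apply filterlim_id.
      + apply continuous_sqrt. }
  destruct (Rle_dec x (/2)) as [H | H]; [ | apply Hpos; lra ].
  destruct (Rle_dec x (-/2)) as [H' | H'].
  - apply continuity_pt_filterlim.
    apply filterlim_ext with (fun y => PI - acos (- y)).
    { intros y. rewrite acos_opp. ring. }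
    replace (acos x) with (PI - acos (- x)) by (rewrite acos_opp; ring).
    assert (FF : Filter (locally x)) by apply filter_filter.
    apply lim_minus; trivial; [ apply filterlim_const | ].
    apply (lim_comp _ acos). apply Hpos; lra. apply lim_opp, filterlim_id.
  - apply derivable_continuous_pt, derivable_pt_acos. lra.
Qed.

(** Continuity of the argument on the closed upper half-plane without 0: for
    values kept in that half-plane the negative axis is not a branch cut. *)
Lemma lim_Carg {T} (F : (T -> Prop) -> Prop) {FF : Filter F} (p q : T -> R) (a b : R) :
  F (fun s => 0 <= q s) -> 0 <= b -> 0 < Cmod (a, b) ->
  filterlim p F (locally a) -> filterlim q F (locally b) ->
  filterlim (fun s => Carg (p s, q s)) F (locally (Carg (a, b))).
Proof.
  intros Hq Hb Hm Hlp Hlq.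
  apply filterlim_ext_loc with (fun s => acos (p s / Cmod (p s, q s))).
  { revert Hq. apply filter_imp. intros s Hs. now rewrite Carg_acos. }
  rewrite Carg_acos by trivial.
  apply (lim_comp F acos). apply continuity_acos, cos_Carg_range, Hm.
  apply lim_div; trivial. lra. now apply lim_Cmod.
Qed.

Lemma lim_from_cos {T} (F : (T -> Prop) -> Prop) {FF : Filter F} (theta : T -> R) (l : R) :
  F (fun s => 0 <= theta s <= PI) -> 0 <= l <= PI ->
  filterlim (fun s => cos (theta s)) F (locally (cos l)) -> filterlim theta F (locally l).
Proof.
  intros Ht Hl Hc. rewrite <- (acos_cos l) by trivial.
  apply filterlim_ext_loc with (fun s => acos (cos (theta s))).
  { revert Ht. apply filter_imp. intros s Hs. now apply acos_cos. }
  apply (lim_comp F acos); trivial. apply continuity_acos, COS_bound.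
Qed.

Lemma is_derive_Carg (p q : R -> R) (s p' q' : R) :
  0 < q s -> is_derive p s p' -> is_derive q s q' ->
  is_derive (fun r => Carg (p r, q r)) s ((p s * q' - q s * p') / (p s ^ 2 + q s ^ 2)).
Proof.
  intros Hq Hp' Hq'.
  apply is_derive_ext_loc with (fun r => PI / 2 - atan (p r / q r)).
  - assert (H : locally s (fun r => 0 < q r)).
    { apply (ex_derive_continuous q s); [ now exists q' | now apply (open_gt 0 (q s)) ]. }
    revert H. apply filter_imp. intros r Hr. now rewrite Carg_atan.
  - auto_derive.
    + repeat split; [ now exists p' | now exists q' | lra ].
    + rewrite (is_derive_unique (fun r : R => p r) s p' Hp'), (is_derive_unique (fun r : R => q r) s q' Hq').
      field. split; [ nra | lra ].
Qed.

Lemma is_derive_ln_Cmod (p q : R -> R) (s p' q' : R) :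
  0 < q s -> is_derive p s p' -> is_derive q s q' ->
  is_derive (fun r => ln (Cmod (p r, q r))) s ((p s * p' + q s * q') / (p s ^ 2 + q s ^ 2)).
Proof.
  intros Hq Hp' Hq'.
  unfold Cmod; simpl.
  assert (0 < p s * (p s * 1) + q s * (q s * 1)) by nra.
  assert (Hs := sqrt_lt_R0 _ H).
  auto_derive.
  - repeat split; try (now exists p'); try (now exists q'); lra.
  - rewrite (is_derive_unique (fun r : R => p r) s p' Hp'), (is_derive_unique (fun r : R => q r) s q' Hq').
    set (m := sqrt _) in *.
    assert (Hm : m * m = p s * (p s * 1) + q s * (q s * 1)) by (apply sqrt_sqrt; lra).
    apply Rmult_eq_reg_r with (p s * (p s * 1) + q s * (q s * 1)). 2: lra.
    rewrite <- Hm at 1. field. lra.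
Qed.

(** * Loewner flow lines *)

Lemma loewner_field_components (z : C) (a : R) : z <> RtoC a ->
  let N := (Re z - a) ^ 2 + Im z ^ 2 in
  0 < N /\ Re (2 / (z - a))%C = 2 * (Re z - a) / N /\ Im (2 / (z - a))%C = - 2 * Im z / N.
Proof.
  destruct z as [p q]; simpl. intros H.
  assert (HN : 0 < (p - a) * ((p - a) * 1) + q * (q * 1)).
  { destruct (Req_dec q 0) as [-> | Hq].
    - assert (Hp : p - a <> 0) by (intros Hp; apply H; unfold RtoC; f_equal; lra).
      apply Rsqr_pos_lt in Hp. unfold Rsqr in Hp. lra.
    - apply Rsqr_pos_lt in Hq. pose proof (Rle_0_sqr (p - a)) as Hp.
      unfold Rsqr in *. lra. }
  repeat split; trivial; field; lra.
Qed.

Lemma loewner_solution_components (W : R -> R) (z : C) (T : R) (u : R -> C) :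
  loewner_solution W z T u ->
  continuous_on_segment T (fun s => Re (u s)) /\ continuous_on_segment T (fun s => Im (u s)) /\
  forall s, 0 < s < T ->
    let N := (Re (u s) - W s) ^ 2 + Im (u s) ^ 2 in
    is_derive (fun r => Re (u r)) s (2 * (Re (u s) - W s) / N) /\
    is_derive (fun r => Im (u r)) s (- 2 * Im (u s) / N).
Proof.
  intros [H0 [Hn [Hc Hd]]]. split; [ | split ].
  - intros s Hs. apply (lim_Re _ u). apply (Hc s Hs).
  - intros s Hs. apply (lim_Im _ u). apply (Hc s Hs).
  - intros s Hs. destruct (loewner_field_components (u s) (W s) (Hn s ltac:(lra))) as [_ [E1 E2]].
    cbv zeta. rewrite <- E1, <- E2. split; [ apply is_derive_Re | apply is_derive_Im ]; now apply Hd.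
Qed.

(** The imaginary part satisfies q' = -2 q / |u - W|^2, so it decreases in
    absolute value and cannot cross 0 before a time at which it is positive. *)
Lemma loewner_solution_Im_pos (W : R -> R) (z : C) (T : R) (u : R -> C) :
  0 <= T -> loewner_solution W z T u -> 0 < Im (u T) -> forall s, 0 <= s <= T -> 0 < Im (u s).
Proof.
  intros HT Hu Hpos s Hs. assert (Hn := proj1 (proj2 Hu)).
  destruct (loewner_solution_components W z T u Hu) as [_ [Hc Hd]].
  apply (segment_same_sign (fun r => Im (u r)) T T s); trivial; try lra.
  clear s Hs. intros s Hs E.
  (* The square of the imaginary part is nonincreasing, hence at least its
     positive final value. *)
  destruct (MVT_segment (fun r => Im (u r) * Im (u r))
     (fun r => - (4 * (Im (u r) * Im (u r)) / ((Re (u r) - W r) ^ 2 + Im (u r) ^ 2))) T s T) as [c Ec];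
    try lra.
  - intros r Hr. apply lim_mult; try now apply Hc. apply filter_filter || typeclasses eauto.
  - intros r Hr. destruct (Hd r Hr) as [_ H].
    destruct (loewner_field_components (u r) (W r) (Hn r ltac:(lra))) as [HN _].
    evar_last.
    + apply (is_derive_mult (fun r => Im (u r)) (fun r => Im (u r)) r _ _ H H).
      intros; apply Rmult_comm.
    + unfold plus, mult; simpl. field. simpl in HN. lra.
  - rewrite E in Ec.
    assert (0 <= 4 * (Im (u c) * Im (u c)) / ((Re (u c) - W c) ^ 2 + Im (u c) ^ 2)).
    { apply Rmult_le_pos. nra.
      destruct (Req_dec ((Re (u c) - W c) ^ 2 + Im (u c) ^ 2) 0) as [-> | Hz].
      rewrite Rinv_0; lra. apply Rlt_le, Rinv_0_lt_compat.
      pose proof (pow2_ge_0 (Re (u c) - W c)). pose proof (pow2_ge_0 (Im (u c))). lra. }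
    nra.
Qed.

(** * The gap and the lifetime *)

(** [D] is the gap x - W between the force point and the driving function. The
    two equations x' = 2 / D and W' = - rho / D give D' = (2 + rho) / D, which is
    2 e / D with e = (rho + 2) / 2; the square of the gap is then affine in time. *)
Record gap_dynamics (e x0 : R) (tau : Rbar) (D : R -> R) : Prop := {
  gap_continuous : forall t, 0 <= t -> Rbar_lt t tau -> continuous_on_segment t D;
  gap_derive : forall t, 0 < t -> Rbar_lt t tau -> is_derive D t (2 * e / D t);
  gap_pos : forall t, 0 <= t -> Rbar_lt t tau -> 0 < D t;
  gap_sq : forall t, 0 <= t -> Rbar_lt t tau -> D t ^ 2 = x0 ^ 2 + 4 * e * t }.

Lemma right_continuous_within_segment (W : R -> R) (T : R) :
  filterlim W (at_right 0) (locally (W 0)) ->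
  filterlim W (within (fun r => 0 <= r <= T) (locally 0)) (locally (W 0)).
Proof.
  intros H P HP. specialize (H P HP). unfold filtermap, at_right, within in *.
  revert H. apply filter_imp. intros r Hr Hr'.
  destruct (Rle_lt_or_eq_dec 0 r (proj1 Hr')) as [Hr1 | <-]; [ now apply Hr | ].
  now apply locally_singleton.
Qed.

Lemma exists_later (t : R) (tau : Rbar) : Rbar_lt t tau -> exists t', t < t' /\ Rbar_lt t' tau.
Proof.
  destruct tau as [T | | ]; simpl; intros H.
  - exists ((t + T) / 2). simpl; lra.
  - exists (t + 1). simpl; split; trivial; lra.
  - contradiction.
Qed.

Lemma SLE0_gap_dynamics (rho x0 : R) (tau : Rbar) (W x : R -> R)
    (g ginv : R -> C -> C) (gamma : R -> C) :
  0 < x0 -> is_SLE0_rho rho x0 tau W x g ginv gamma ->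
  (forall t, 0 <= t -> Rbar_lt t tau -> continuous_on_segment t x) /\
  (forall t, 0 < t -> Rbar_lt t tau -> is_derive x t (2 / (x t - W t))) /\
  gap_dynamics ((rho + 2) / 2) x0 tau (fun t => x t - W t).
Proof.
  intros Hx0 H.
  assert (Hle : forall s t, s <= t -> Rbar_lt t tau -> Rbar_lt s tau).
  { intros s t Hst Ht. apply Rbar_le_lt_trans with t; trivial. }
  assert (HW : forall t, 0 <= t -> Rbar_lt t tau -> continuous_on_segment t W).
  { intros t Ht Htau s Hs.
    destruct (Rle_lt_or_eq_dec 0 s (proj1 Hs)) as [Hs1 | <-].
    - apply (filterlim_filter_le_1 (F := locally s)).
      + intros P HP. unfold within. revert HP. now apply filter_imp.
      + apply (ex_derive_continuous W s).
        exists (rho / (W s - x s)). apply (sle_driving_ode _ _ _ _ _ _ _ _ H); trivial.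
        apply Hle with t; trivial; lra.
    - apply right_continuous_within_segment, (sle_driving_cont0 _ _ _ _ _ _ _ _ H). }
  assert (Hsol : forall t, 0 <= t -> Rbar_lt t tau ->
            loewner_solution W x0 t (fun s => g s x0)).
  { intros t Ht Htau. apply (sle_flow _ _ _ _ _ _ _ _ H); trivial.
    now apply (sle_force_point _ _ _ _ _ _ _ _ H). }
  assert (Hgx : forall s, 0 <= s -> Rbar_lt s tau -> g s x0 = RtoC (x s)).
  { intros s Hs Hs'. now apply (sle_force_point _ _ _ _ _ _ _ _ H). }
  assert (Hx00 : 0 <= 0 -> Rbar_lt 0 tau -> x 0 = x0).
  { intros H1 H2. destruct (Hsol 0 H1 H2) as [E _]. rewrite (Hgx 0 H1 H2) in E. now injection E. }
  assert (Hxc : forall t, 0 <= t -> Rbar_lt t tau -> continuous_on_segment t x).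
  { intros t Ht Htau s Hs.
    destruct (loewner_solution_components _ _ _ _ (Hsol t Ht Htau)) as [Hc _].
    specialize (Hc s Hs). cbv beta in Hc.
    rewrite Hgx in Hc; [ | lra | apply Hle with t; trivial; lra ].
    eapply filterlim_within_ext; cycle 1. exact Hc.
    intros r Hr. cbv beta. rewrite Hgx; [ reflexivity | lra | apply Hle with t; trivial; lra ]. }
  assert (Hne : forall t, 0 <= t -> Rbar_lt t tau -> x t - W t <> 0).
  { intros t Ht Htau E. apply (proj1 (proj2 (Hsol t Ht Htau)) t). lra.
    rewrite Hgx by trivial. f_equal; lra. }
  assert (Hxd : forall t, 0 < t -> Rbar_lt t tau -> is_derive x t (2 / (x t - W t))).
  { intros t Ht Htau. destruct (exists_later t tau Htau) as [t' [Htt Ht']].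
    destruct (loewner_solution_components _ _ _ _ (Hsol t' ltac:(lra) Ht')) as [_ [_ Hd]].
    destruct (Hd t ltac:(lra)) as [Hd1 _].
    rewrite Hgx in Hd1 by (trivial; lra). simpl in Hd1.
    apply is_derive_ext_loc with (fun r => Re (g r x0)).
    - assert (Hr : locally t (fun r => 0 < r < t')).
      { apply (locally_interval _ t 0 t'); simpl; tauto. }
      revert Hr. apply filter_imp. intros r Hr.
      rewrite Hgx; [ reflexivity | lra | apply Hle with t'; trivial; lra ].
    - evar_last. exact Hd1.
      specialize (Hne t ltac:(lra) Htau). field. trivial. }
  assert (Hgd : forall t, 0 < t -> Rbar_lt t tau ->
     is_derive (fun s => x s - W s) t (2 * ((rho + 2) / 2) / (x t - W t))).
  { intros t Ht Htau. evar_last.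
    - exact (is_derive_minus x W t _ _ (Hxd t Ht Htau)
        (sle_driving_ode _ _ _ _ _ _ _ _ H t Ht Htau)).
    - specialize (Hne t ltac:(lra) Htau). unfold minus, plus, opp; simpl. field. split; trivial.
      lra. }
  assert (Hgc : forall t, 0 <= t -> Rbar_lt t tau -> continuous_on_segment t (fun s => x s - W s)).
  { intros t Ht Htau s Hs. apply lim_minus; [ apply within_filter, filter_filter | | ].
    now apply Hxc. now apply HW. }
  split; [ | split ]; trivial. split; trivial.
  - intros t Ht Htau. assert (H0 : Rbar_lt 0 tau) by now apply Hle with t.
    apply (segment_same_sign (fun s => x s - W s) t 0 t); try lra.
    + now apply Hgc.
    + intros s Hs. apply Hne. lra. apply Hle with t; trivial; lra.
    + rewrite (sle_driving_start _ _ _ _ _ _ _ _ H), (Hx00 (Rle_refl 0) H0). lra.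
  - intros t Ht Htau. assert (H0 : Rbar_lt 0 tau) by now apply Hle with t.
    pose proof (segment_constant
      (fun s => (x s - W s) * (x s - W s) - 4 * ((rho + 2) / 2) * s) t Ht) as Hcst.
    cbv beta in Hcst. assert (E : x 0 - W 0 = x0).
    { rewrite (sle_driving_start _ _ _ _ _ _ _ _ H), (Hx00 (Rle_refl 0) H0). lra. }
    rewrite E in Hcst.
    enough ((x t - W t) * (x t - W t) - 4 * ((rho + 2) / 2) * t =
      x0 * x0 - 4 * ((rho + 2) / 2) * 0) by lra.
    apply Hcst; try lra.
    + intros s Hs. assert (FF : Filter (within (fun r => 0 <= r <= t) (locally s)))
        by apply within_filter, filter_filter.
      apply lim_minus; trivial.
      apply lim_mult; trivial; now apply Hgc.
      apply lim_mult; trivial. apply filterlim_const.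
      intros P HP. unfold filtermap, within. revert HP; now apply filter_imp.
    + intros s Hs. assert (Hs' : Rbar_lt s tau) by (apply Hle with t; trivial; lra).
      specialize (Hgd s ltac:(lra) Hs').
      specialize (Hne s ltac:(lra) Hs').
      evar_last.
      * exact (is_derive_minus _ _ s _ _
          (is_derive_mult _ _ s _ _ Hgd Hgd Rmult_comm)
          (is_derive_scal _ s (4 * ((rho + 2) / 2)) _ (is_derive_id s))).
      * unfold minus, plus, opp, mult, scal, one; simpl. unfold mult; simpl. field. trivial.
Qed.

(** If the gap stays above [delta] then no hitting time exists for smaller
    levels, and the limit of the hitting times is infinite. *)
Lemma lifetime_infinite (tau : Rbar) (W x : R -> R) (delta : R) :
  0 < delta -> is_Rbar_limit (at_right 0) (hitting_time tau W x) tau ->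
  (forall t, 0 <= t -> Rbar_lt t tau -> delta <= Rabs (W t - x t)) ->
  tau = p_infty.
Proof.
  intros Hdelta [_ Hlim] Hfar.
  assert (Hinf : forall eps, 0 < eps < delta -> hitting_time tau W x eps = p_infty).
  { intros eps Heps. apply is_glb_Rbar_unique. split.
    - intros t [Ht [Htau E]]. specialize (Hfar t Ht Htau). lra.
    - intros b _. now destruct b. }
  assert (Hb : forall b : R, ~ Rbar_lt tau b).
  { intros b Hb.
    assert (Hev : at_right 0 (fun eps => 0 < eps < delta)).
    { exists (mkposreal delta Hdelta). intros eps Hball Hpos. split; trivial.
      change (Rabs (eps - 0) < delta) in Hball. apply Rabs_def2 in Hball. lra. }
    destruct (filter_ex _ (filter_and _ _ (Hlim b Hb) Hev)) as [eps [H1 H2]].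
    rewrite Hinf in H1 by trivial. exact H1. }
  destruct tau as [T | | ]; trivial; exfalso.
  - apply (Hb (T + 1)). simpl; lra.
  - now apply (Hb 0).
Qed.

(** The squared gap x0^2 + 4 e t vanishes at - x0^2 / (4 e) when e < 0 and never
    drops below x0^2 otherwise. *)
Lemma SLE0_lifetime (e x0 : R) (tau : Rbar) (W x : R -> R) :
  0 < x0 -> gap_dynamics e x0 tau (fun t => x t - W t) ->
  is_Rbar_limit (at_right 0) (hitting_time tau W x) tau ->
  (0 <= e -> tau = p_infty) /\ (e < 0 -> tau = Finite (- (x0 ^ 2 / (4 * e)))).
Proof.
  intros Hx0 [_ _ Hpos Hsq] Hlim.
  assert (Hfar : forall delta, 0 < delta ->
     (forall t, 0 <= t -> Rbar_lt t tau -> delta ^ 2 <= x0 ^ 2 + 4 * e * t) -> tau = p_infty).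
  { intros delta Hdelta Hd. apply (lifetime_infinite tau W x delta); trivial.
    intros t Ht Htau. specialize (Hd t Ht Htau).
    rewrite <- (Hsq t Ht Htau) in Hd. specialize (Hpos t Ht Htau). cbv beta in *.
    rewrite Rabs_left by lra. nra. }
  split; intros He.
  - apply (Hfar x0); trivial. intros t Ht Htau. nra.
  - set (T := - (x0 ^ 2 / (4 * e))).
    assert (HT : x0 ^ 2 + 4 * e * T = 0) by (unfold T; field; lra).
    assert (HT0 : 0 < T) by nra.
    assert (Hle : ~ Rbar_lt T tau).
    { intros H. specialize (Hpos T ltac:(lra) H). specialize (Hsq T ltac:(lra) H).
      cbv beta in *. nra. }
    (* A lifetime shorter than [T] would keep the gap away from 0. *)
    assert (Hge : forall b : R, 0 <= b < T -> (forall t : R, Rbar_lt t tau -> t <= b) -> False).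
    { intros b Hb H.
      assert (Hd : 0 < x0 ^ 2 + 4 * e * b) by (assert (0 < - e * (T - b)) by (apply Rmult_lt_0_compat; lra); lra).
      rewrite (Hfar (sqrt (x0 ^ 2 + 4 * e * b))) in Hle.
      - now apply Hle.
      - now apply sqrt_lt_R0.
      - intros t Ht Htau. rewrite pow2_sqrt by lra. specialize (H t Htau).
        assert (0 <= - e * (b - t)) by (apply Rmult_le_pos; lra). lra. }
    destruct tau as [r | | ].
    + f_equal. simpl in Hle. destruct (Rle_lt_or_eq_dec r T); [ lra | | trivial ].
      exfalso. apply (Hge (Rmax 0 r)).
      * split. apply Rmax_l. apply Rmax_lub_lt; lra.
      * simpl. intros t Ht. apply Rle_trans with r. lra. apply Rmax_r.
    + exfalso. now apply Hle.
    + exfalso. apply (Hge 0). lra. simpl. contradiction.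
Qed.

(** * Conserved quantities of the flow *)

(** A flow line seen from the force point: p + i q = g_s(z) - x_s, and the
    point (p + D) + i q = g_s(z) - W_s is the one in the Loewner equation. The
    line is run up to time [t], where it sits at height [y] above the driving
    point, that is at -D + i y in these coordinates. *)
Record flow_line (e x0 t y : R) (D p q : R -> R) : Prop := {
  line_gap0 : D 0 = x0;
  line_gap_pos : forall s, 0 <= s <= t -> 0 < D s;
  line_Im_pos : forall s, 0 <= s <= t -> 0 < q s;
  line_tip : p t = - D t /\ q t = y;
  line_cont : continuous_on_segment t D /\ continuous_on_segment t p /\ continuous_on_segment t q;
  line_gap_derive : forall s, 0 < s < t -> is_derive D s (2 * e / D s);
  line_Re_derive : forall s, 0 < s < t ->
    is_derive p s (- 2 * (p s * (p s + D s) + q s ^ 2) / (((p s + D s) ^ 2 + q s ^ 2) * D s));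
  line_Im_derive : forall s, 0 < s < t ->
    is_derive q s (- 2 * q s / ((p s + D s) ^ 2 + q s ^ 2)) }.

Lemma tip_flow_line (rho x0 : R) (tau : Rbar) (W x : R -> R)
    (g ginv : R -> C -> C) (gamma : R -> C) (t y : R) :
  0 < x0 -> is_SLE0_rho rho x0 tau W x g ginv gamma ->
  0 <= t -> Rbar_lt t tau -> 0 < y ->
  let z := ginv t (W t + Ci * y)%C in
  exists p q, p 0 = Re z - x0 /\ q 0 = Im z /\
    flow_line ((rho + 2) / 2) x0 t y (fun s => x s - W s) p q.
Proof.
  intros Hx0 H Ht Htau Hy z.
  destruct (SLE0_gap_dynamics _ _ _ _ _ _ _ _ Hx0 H) as [Hx [Hxd [Hgc Hgd Hgp Hgs]]].
  assert (Ew : (W t + Ci * y)%C = (W t, y)).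
  { unfold Ci, RtoC, Cplus, Cmult; simpl. f_equal; ring. }
  destruct (proj2 (sle_inverse _ _ _ _ _ _ _ _ H t Ht Htau) (W t + Ci * y)%C) as [[Hz Hdom] Hg].
  { rewrite Ew. exact Hy. }
  fold z in Hz, Hdom, Hg.
  assert (Hsol := sle_flow _ _ _ _ _ _ _ _ H t z Ht Htau Hdom).
  destruct (loewner_solution_components _ _ _ _ Hsol) as [Hcp [Hcq Hd]].
  assert (Hle : forall s, s <= t -> Rbar_lt s tau).
  { intros s Hst. apply Rbar_le_lt_trans with t; trivial. }
  assert (Hqpos : forall s, 0 <= s <= t -> 0 < Im (g s z)).
  { apply (loewner_solution_Im_pos _ _ _ _ Ht Hsol). rewrite Hg, Ew. exact Hy. }
  assert (Hgz0 : g 0 z = z) by apply Hsol.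
  assert (Hx00 : x 0 = x0).
  { assert (E := Hgs 0 (Rle_refl 0) (Hle 0 Ht)). assert (E' := Hgp 0 (Rle_refl 0) (Hle 0 Ht)).
    cbv beta in *. rewrite (sle_driving_start _ _ _ _ _ _ _ _ H) in *. nra. }
  exists (fun s => Re (g s z) - x s), (fun s => Im (g s z)).
  split; [ now rewrite Hgz0, Hx00 | split; [ now rewrite Hgz0 | ] ].
  split.
  - rewrite Hx00, (sle_driving_start _ _ _ _ _ _ _ _ H). ring.
  - intros s Hs. apply Hgp; [ lra | now apply Hle ].
  - exact Hqpos.
  - rewrite Hg, Ew. simpl. split; [ ring | reflexivity ].
  - split; [ now apply Hgc | split; trivial ].
    intros s Hs. apply lim_minus; [ apply within_filter, filter_filter | | ].
    now apply Hcp. now apply Hx.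
  - intros s Hs. apply Hgd; [ lra | apply Hle; lra ].
  - intros s Hs. destruct (Hd s Hs) as [H1 _].
    assert (Hs' : Rbar_lt s tau) by (apply Hle; lra).
    assert (H2 := Hxd s ltac:(lra) Hs'). assert (H3 := Hgp s ltac:(lra) Hs').
    assert (H4 := Hqpos s ltac:(lra)). cbv beta in *.
    evar_last. exact (is_derive_minus _ _ s _ _ H1 H2).
    unfold minus, plus, opp; simpl. field. split; [ lra | apply sum_sq_neq_0; lra ].
  - intros s Hs. destruct (Hd s Hs) as [_ H1]. cbv beta in *.
    replace (Re (g s z) - x s + (x s - W s)) with (Re (g s z) - W s) by ring. exact H1.
Qed.

(** The Loewner equation conserves Y^e (Y + (1 + 1/e) D), where Y = g - x: up to
    a constant factor it is a primitive in z of the conserved density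
    g_t'(z) (g_t(z) - W_t) (g_t(z) - x_t)^(rho/2). Both factors stay in the upper
    half-plane, so modulus and argument can be followed separately without
    ambiguity of branch. *)
Lemma log_invariant (e x0 t y : R) (D p q : R -> R) :
  e <> 0 -> 0 <= t -> flow_line e x0 t y D p q ->
  e * ln (Cmod (p 0, q 0)) + ln (Cmod (p 0 + (1 + / e) * x0, q 0)) =
  e * ln (Cmod (- D t, y)) + ln (Cmod (D t / e, y)) /\
  e * Carg (p 0, q 0) + Carg (p 0 + (1 + / e) * x0, q 0) =
  e * Carg (- D t, y) + Carg (D t / e, y).
Proof.
  intros He Ht [H0 HD Hq [Tp Tq] [CD [Cp Cq]] DD Dp Dq].
  rewrite <- H0, <- Tq.
  replace (D t / e) with (p t + (1 + / e) * D t) by (rewrite Tp; field; trivial).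
  rewrite <- Tp.
  assert (FF : forall s, Filter (within (fun r => 0 <= r <= t) (locally s))).
  { intros s. apply within_filter, filter_filter. }
  assert (CB : continuous_on_segment t (fun s => p s + (1 + / e) * D s)).
  { intros s Hs. apply lim_plus; trivial. now apply Cp.
    apply lim_mult; trivial. apply filterlim_const. now apply CD. }
  assert (DB : forall s, 0 < s < t -> is_derive (fun s => p s + (1 + / e) * D s) s
      (- 2 * (p s * (p s + D s) + q s ^ 2) / (((p s + D s) ^ 2 + q s ^ 2) * D s)
        + (1 + / e) * (2 * e / D s))).
  { intros s Hs. exact (is_derive_plus _ _ s _ _ (Dp s Hs)
      (is_derive_scal _ s (1 + / e) _ (DD s Hs))). }
  split; symmetry.
  - apply (segment_constant (fun s => e * ln (Cmod (p s, q s)) +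
       ln (Cmod (p s + (1 + / e) * D s, q s)))) with (T := t); try lra.
    + intros s Hs. specialize (Hq s Hs).
      apply lim_plus; trivial; [ apply lim_mult; trivial; [ apply filterlim_const | ] | ];
      (apply lim_ln; [ now apply Cmod_pos_Im | apply lim_Cmod; trivial; auto ]).
    + intros s Hs. specialize (HD s ltac:(lra)). specialize (Hq s ltac:(lra)).
      evar_last.
      * exact (is_derive_plus _ _ s _ _
          (is_derive_scal _ s e _ (is_derive_ln_Cmod p q s _ _ Hq (Dp s Hs) (Dq s Hs)))
          (is_derive_ln_Cmod _ q s _ _ Hq (DB s Hs) (Dq s Hs))).
      * unfold plus, scal, mult; simpl. unfold mult; simpl. field.
        assert (e * q s <> 0) by (apply Rmult_integral_contrapositive; lra).
        repeat split; trivial; try lra; try (apply sum_sq_neq_0; lra).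
        replace (q s * q s * (e * e)) with ((e * q s) * (e * q s)) by ring.
        now apply sum_sq_neq_0.
  - apply (segment_constant (fun s => e * Carg (p s, q s) +
       Carg (p s + (1 + / e) * D s, q s))) with (T := t); try lra.
    + intros s Hs.
      assert (Hev : within (fun r => 0 <= r <= t) (locally s) (fun r => 0 <= q r)).
      { unfold within. apply filter_forall. intros r Hr. apply Rlt_le, Hq, Hr. }
      specialize (Hq s Hs).
      apply lim_plus; trivial; [ apply lim_mult; trivial; [ apply filterlim_const | ] | ];
      (apply lim_Carg; trivial; try lra; try (now apply Cmod_pos_Im); auto).
    + intros s Hs. specialize (HD s ltac:(lra)). specialize (Hq s ltac:(lra)).
      evar_last.
      * exact (is_derive_plus _ _ s _ _
          (is_derive_scal _ s e _ (is_derive_Carg p q s _ _ Hq (Dp s Hs) (Dq s Hs)))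
          (is_derive_Carg _ q s _ _ Hq (DB s Hs) (Dq s Hs))).
      * unfold plus, scal, mult; simpl. unfold mult; simpl. field.
        assert (e * q s <> 0) by (apply Rmult_integral_contrapositive; lra).
        repeat split; trivial; try lra; try (apply sum_sq_neq_0; lra).
        replace (q s * q s * (e * e)) with ((e * q s) * (e * q s)) by ring.
        now apply sum_sq_neq_0.
Qed.

(** For rho = -2 the density is 1 + D / Y with constant gap D = x0, and its
    primitive Y + D log Y drifts by 2 t / D. *)
Lemma log_invariant_marginal (x0 t y : R) (D p q : R -> R) :
  0 <= t -> flow_line 0 x0 t y D p q ->
  p 0 + x0 * ln (Cmod (p 0, q 0)) = - x0 + x0 * ln (Cmod (- x0, y)) + 2 * t / x0 /\
  q 0 + x0 * Carg (p 0, q 0) = y + x0 * Carg (- x0, y).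
Proof.
  intros Ht [H0 HD Hq [Tp Tq] [CD [Cp Cq]] DD Dp Dq].
  assert (HD0 : forall s, 0 <= s <= t -> D s = x0).
  { rewrite <- H0. apply segment_constant; trivial.
    intros s Hs. evar_last. now apply DD. specialize (HD s ltac:(lra)). field; lra. }
  assert (Hx0 : 0 < x0) by (rewrite <- H0; apply HD; lra).
  rewrite HD0 in Tp by lra. rewrite <- Tq.
  assert (FF : forall s, Filter (within (fun r => 0 <= r <= t) (locally s))).
  { intros s. apply within_filter, filter_filter. }
  split.
  - enough (E : p t + x0 * ln (Cmod (p t, q t)) + 2 / x0 * t =
      p 0 + x0 * ln (Cmod (p 0, q 0)) + 2 / x0 * 0).
    { rewrite Tp in E. lra. }
    apply (segment_constant (fun s => p s + x0 * ln (Cmod (p s, q s)) + 2 / x0 * s))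
      with (T := t); try lra.
    + intros s Hs. specialize (Hq s Hs).
      apply lim_plus; trivial; [ apply lim_plus; trivial; [ now apply Cp | ] | ];
        (apply lim_mult; trivial; [ apply filterlim_const | ]).
      * apply lim_ln; [ now apply Cmod_pos_Im | apply lim_Cmod; trivial; auto ].
      * intros P HP. unfold filtermap, within. revert HP; now apply filter_imp.
    + intros s Hs. specialize (HD0 s ltac:(lra)). specialize (Hq s ltac:(lra)).
      evar_last.
      * exact (is_derive_plus _ _ s _ _ (is_derive_plus _ _ s _ _ (Dp s Hs)
          (is_derive_scal _ s x0 _ (is_derive_ln_Cmod p q s _ _ Hq (Dp s Hs) (Dq s Hs))))
          (is_derive_scal _ s (2 / x0) _ (is_derive_id s))).
      * unfold plus, scal, mult, one; simpl. unfold mult; simpl. rewrite HD0. field.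
        repeat split; try lra; apply sum_sq_neq_0; lra.
  - rewrite <- Tp. symmetry.
    apply (segment_constant (fun s => q s + x0 * Carg (p s, q s))) with (T := t); try lra.
    + intros s Hs.
      assert (Hev : within (fun r => 0 <= r <= t) (locally s) (fun r => 0 <= q r)).
      { unfold within. apply filter_forall. intros r Hr. apply Rlt_le, Hq, Hr. }
      specialize (Hq s Hs).
      apply lim_plus; trivial; [ now apply Cq | ].
      apply lim_mult; trivial; [ apply filterlim_const | ].
      apply lim_Carg; trivial; try lra; try (now apply Cmod_pos_Im); auto.
    + intros s Hs. specialize (HD0 s ltac:(lra)). specialize (Hq s ltac:(lra)).
      evar_last.
      * exact (is_derive_plus _ _ s _ _ (Dq s Hs)
          (is_derive_scal _ s x0 _ (is_derive_Carg p q s _ _ Hq (Dp s Hs) (Dq s Hs)))).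
      * unfold plus, scal, mult; simpl. unfold mult; simpl. rewrite HD0. field.
        repeat split; try lra; apply sum_sq_neq_0; lra.
Qed.

(** For rho = -4 the density is Y^(-1) + D Y^(-2), whose primitive is
    log Y - D / Y. *)
Lemma log_invariant_tangential (x0 t y : R) (D p q : R -> R) :
  0 <= t -> flow_line (-1) x0 t y D p q ->
  ln (Cmod (p 0, q 0)) - x0 * (p 0 / (p 0 * p 0 + q 0 * q 0)) =
    ln (Cmod (- D t, y)) + D t * (D t / (D t * D t + y * y)) /\
  Carg (p 0, q 0) + x0 * (q 0 / (p 0 * p 0 + q 0 * q 0)) =
    Carg (- D t, y) + D t * (y / (D t * D t + y * y)).
Proof.
  intros Ht [H0 HD Hq [Tp Tq] [CD [Cp Cq]] DD Dp Dq].
  rewrite <- H0, <- Tq.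
  replace (D t * D t + q t * q t) with (p t * p t + q t * q t) by (rewrite Tp; ring).
  assert (FF : forall s, Filter (within (fun r => 0 <= r <= t) (locally s))).
  { intros s. apply within_filter, filter_filter. }
  assert (CN : continuous_on_segment t (fun s => p s * p s + q s * q s)).
  { intros s Hs. apply lim_plus; trivial; apply lim_mult; trivial; auto. }
  assert (DN : forall (r : R -> R) r' s, 0 < s < t -> is_derive r s r' ->
     is_derive (fun s => D s * (r s / (p s * p s + q s * q s))) s
       (- 2 / D s * (r s / (p s * p s + q s * q s)) +
        D s * ((r' * (p s * p s + q s * q s) - r s *
          (2 * p s * (- 2 * (p s * (p s + D s) + q s ^ 2) / (((p s + D s) ^ 2 + q s ^ 2) * D s))
           + 2 * q s * (- 2 * q s / ((p s + D s) ^ 2 + q s ^ 2)))) / (p s * p s + q s * q s) ^ 2))).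
  { intros r r' s Hs Hr.
    assert (HN : p s * p s + q s * q s <> 0).
    { apply sum_sq_neq_0. specialize (Hq s ltac:(lra)). lra. }
    evar_last.
    - exact (is_derive_mult _ _ s _ _ (DD s Hs) (is_derive_div _ _ s _ _ Hr
        (is_derive_plus _ _ s _ _
           (is_derive_mult _ _ s _ _ (Dp s Hs) (Dp s Hs) Rmult_comm)
           (is_derive_mult _ _ s _ _ (Dq s Hs) (Dq s Hs) Rmult_comm)) HN) Rmult_comm).
    - unfold plus, mult; simpl. specialize (HD s ltac:(lra)). specialize (Hq s ltac:(lra)).
      field. repeat split; try lra; apply sum_sq_neq_0; lra. }
  split; symmetry.
  - replace (ln (Cmod (- D t, q t)) + D t * (D t / (p t * p t + q t * q t)))
      with (ln (Cmod (p t, q t)) - D t * (p t / (p t * p t + q t * q t))).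
    2: { rewrite Tp. unfold Rdiv. ring. }
    apply (segment_constant (fun s => ln (Cmod (p s, q s)) -
       D s * (p s / (p s * p s + q s * q s)))) with (T := t); try lra.
    + intros s Hs. specialize (Hq s Hs).
      apply lim_minus; trivial.
      * apply lim_ln; [ now apply Cmod_pos_Im | apply lim_Cmod; trivial; auto ].
      * apply lim_mult; trivial; [ now apply CD | ].
        apply lim_div; trivial; [ apply sum_sq_neq_0; lra | now apply Cp | now apply CN ].
    + intros s Hs. specialize (HD s ltac:(lra)). specialize (Hq s ltac:(lra)).
      evar_last.
      * exact (is_derive_minus _ _ s _ _
          (is_derive_ln_Cmod p q s _ _ Hq (Dp s Hs) (Dq s Hs)) (DN p _ s Hs (Dp s Hs))).
      * unfold minus, plus, opp; simpl. field.
        repeat split; try lra; apply sum_sq_neq_0; lra.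
  - rewrite <- Tp.
    apply (segment_constant (fun s => Carg (p s, q s) +
       D s * (q s / (p s * p s + q s * q s)))) with (T := t); try lra.
    + intros s Hs.
      assert (Hev : within (fun r => 0 <= r <= t) (locally s) (fun r => 0 <= q r)).
      { unfold within. apply filter_forall. intros r Hr. apply Rlt_le, Hq, Hr. }
      specialize (Hq s Hs).
      apply lim_plus; trivial.
      * apply lim_Carg; trivial; try lra; try (now apply Cmod_pos_Im); auto.
      * apply lim_mult; trivial; [ now apply CD | ].
        apply lim_div; trivial; [ apply sum_sq_neq_0; lra | now apply Cq | now apply CN ].
    + intros s Hs. specialize (HD s ltac:(lra)). specialize (Hq s ltac:(lra)).
      evar_last.
      * exact (is_derive_plus _ _ s _ _
          (is_derive_Carg p q s _ _ Hq (Dp s Hs) (Dq s Hs)) (DN q _ s Hs (Dq s Hs))).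
      * unfold plus; simpl. field.
        repeat split; try lra; apply sum_sq_neq_0; lra.
Qed.

(** * The equation of the trace *)

(** The trace at time t is the limit, as y decreases to 0, of the starting points
    of the flow lines that end at W_t + i y. *)
Lemma trace_preimages (rho x0 : R) (tau : Rbar) (W x : R -> R)
    (g ginv : R -> C -> C) (gamma : R -> C) (t : R) :
  0 < x0 -> is_SLE0_rho rho x0 tau W x g ginv gamma -> 0 <= t -> Rbar_lt t tau ->
  exists P Q : R -> R,
    filterlim P (at_right 0) (locally (Re (gamma t) - x0)) /\
    filterlim Q (at_right 0) (locally (Im (gamma t))) /\
    forall y, 0 < y -> exists p q, p 0 = P y /\ q 0 = Q y /\ 0 < Q y /\
      flow_line ((rho + 2) / 2) x0 t y (fun s => x s - W s) p q.
Proof.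
  intros Hx0 H Ht Htau.
  exists (fun y => Re (ginv t (W t + Ci * y)%C) - x0), (fun y => Im (ginv t (W t + Ci * y)%C)).
  assert (Hg := sle_trace _ _ _ _ _ _ _ _ H t Ht Htau).
  assert (FF : Filter (at_right 0)) by apply filter_filter.
  split; [ | split ].
  - apply lim_minus; trivial; [ exact (lim_Re _ _ _ Hg) | apply filterlim_const ].
  - exact (lim_Im _ _ _ Hg).
  - intros y Hy. destruct (tip_flow_line _ _ _ _ _ _ _ _ t y Hx0 H Ht Htau Hy) as [p [q [Ep [Eq Hl]]]].
    exists p, q. split; [ | split; [ | split ] ]; trivial. rewrite <- Eq. apply (line_Im_pos _ _ _ _ _ _ _ Hl). lra.
Qed.

(** A bound on alpha log |u| + beta log |u + k| keeps u away from 0, since near 0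
    the second logarithm is close to log |k|. *)
Lemma away_from_zero (alpha beta k M : R) :
  alpha <> 0 -> k <> 0 -> exists delta, 0 < delta /\
  forall p q, 0 < q ->
    Rabs (alpha * ln (Cmod (p, q)) + beta * ln (Cmod (p + k, q))) <= M -> delta <= Cmod (p, q).
Proof.
  intros Ha Hk. apply Rabs_pos_lt in Ha, Hk.
  set (K := Rabs (ln (Rabs k / 2)) + Rabs (ln (2 * Rabs k))).
  exists (Rmin (Rabs k / 2) (exp (- ((M + Rabs beta * K) / Rabs alpha)))). split.
  { apply Rmin_pos. lra. apply exp_pos. }
  intros p q Hq HM.
  destruct (Rle_lt_dec (Rabs k / 2) (Cmod (p, q))) as [H | H].
  { apply Rle_trans with (2 := H), Rmin_l. }
  apply Rle_trans with (1 := Rmin_r _ _).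
  pose proof (Cmod_pos_Im p q Hq) as Hp.
  rewrite <- (exp_ln (Cmod (p, q))) by trivial.
  (* Near 0 the second logarithm is bounded, so the first one is. *)
  assert (HB : Rabs k / 2 <= Cmod (p + k, q) <= 2 * Rabs k).
  { split.
    - pose proof (Cmod_shift (p + k) q (- k)) as H1. rewrite Rabs_Ropp in H1.
      assert (E : Rabs k = Cmod (RtoC k)) by now rewrite Cmod_R.
      assert (H2 : Cmod (RtoC k) <= Cmod (p + k, q) + Cmod (- (p, q))%C).
      { replace (RtoC k) with (Cplus (p + k, q) (- (p, q))%C) at 1.
        apply Cmod_triangle. unfold Cplus, Copp, RtoC; simpl. f_equal; ring. }
      rewrite Cmod_opp in H2. lra.
    - pose proof (Cmod_shift p q k). lra. }
  assert (HL : Rabs (ln (Cmod (p + k, q))) <= K).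
  { assert (H1 : ln (Rabs k / 2) <= ln (Cmod (p + k, q))) by (apply ln_le; lra).
    assert (H2 : ln (Cmod (p + k, q)) <= ln (2 * Rabs k)) by (apply ln_le; lra).
    unfold K, Rabs in *. repeat destruct Rcase_abs; lra. }
  assert (H1 : Rabs alpha * Rabs (ln (Cmod (p, q))) <= M + Rabs beta * K).
  { rewrite <- Rabs_mult.
    replace (alpha * ln (Cmod (p, q))) with
      (alpha * ln (Cmod (p, q)) + beta * ln (Cmod (p + k, q)) - beta * ln (Cmod (p + k, q))) by ring.
    eapply Rle_trans. apply Rabs_triang. rewrite Rabs_Ropp, Rabs_mult.
    apply Rplus_le_compat; trivial. apply Rmult_le_compat_l; trivial. apply Rabs_pos. }
  assert (H2 : Rabs (ln (Cmod (p, q))) <= (M + Rabs beta * K) / Rabs alpha).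
  { apply Rle_div_r; lra. }
  apply Rabs_le_between in H2.
  destruct (Rle_lt_or_eq_dec _ _ (proj1 H2)) as [H3 | ->]; [ left; now apply exp_increasing | lra ].
Qed.

(** Equate the conserved quantity at the start of a flow line, where Y = z - x0
    and D = x0, with its value at the end, where Y = -D + i y, and let y tend
    to 0. The result is the implicit equation
    (gamma - x0)^e (gamma - p) = (-D)^e D / e with p = - x0 / e. *)
Lemma trace_equation (rho x0 : R) (tau : Rbar) (W x : R -> R)
    (g ginv : R -> C -> C) (gamma : R -> C) (t : R) :
  let e := (rho + 2) / 2 in
  let D := x t - W t in
  let a := Re (gamma t) - x0 in
  let b := Im (gamma t) in
  0 < x0 -> is_SLE0_rho rho x0 tau W x g ginv gamma -> 0 <= t -> Rbar_lt t tau ->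
  e <> 0 -> e <> -1 ->
  0 <= b /\ 0 < Cmod (a, b) /\ 0 < Cmod (a + (1 + / e) * x0, b) /\
  e * ln (Cmod (a, b)) + ln (Cmod (a + (1 + / e) * x0, b)) = e * ln D + ln (Rabs (D / e)) /\
  e * Carg (a, b) + Carg (a + (1 + / e) * x0, b) = e * PI + Carg (D / e, 0).
Proof.
  intros e D a b Hx0 H Ht Htau He He'.
  destruct (trace_preimages _ _ _ _ _ _ _ _ t Hx0 H Ht Htau) as [P [Q [LP [LQ HPQ]]]].
  assert (HD : 0 < D).
  { destruct (SLE0_gap_dynamics _ _ _ _ _ _ _ _ Hx0 H) as [_ [_ [_ _ Hp _]]]. now apply Hp. }
  fold e a b in LP, LQ, HPQ.
  assert (FF : ProperFilter (at_right 0)) by apply at_right_proper_filter.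
  assert (FF' : Filter (at_right 0)) by apply filter_filter.
  set (k := (1 + / e) * x0).
  assert (Hk : k <> 0).
  { unfold k. replace ((1 + / e) * x0) with ((e + 1) * x0 / e) by (field; trivial).
    apply Rmult_integral_contrapositive. split; [ nra | now apply Rinv_neq_0_compat ]. }
  assert (HQ : at_right 0 (fun y => 0 < Q y)).
  { generalize at_right_pos. apply filter_imp. intros y Hy. now destruct (HPQ y Hy) as (? & ? & ? & ? & ? & ?). }
  assert (HQ' : at_right 0 (fun y => 0 <= Q y)).
  { revert HQ. apply filter_imp. intros; lra. }
  assert (Hinv : at_right 0 (fun y =>
    e * ln (Cmod (P y, Q y)) + ln (Cmod (P y + k, Q y)) =
    e * ln (Cmod (- D, y)) + ln (Cmod (D / e, y)) /\
    e * Carg (P y, Q y) + Carg (P y + k, Q y) =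
    e * Carg (- D, y) + Carg (D / e, y))).
  { generalize at_right_pos. apply filter_imp. intros y Hy.
    destruct (HPQ y Hy) as (p & q & <- & <- & _ & Hl).
    exact (log_invariant _ _ _ _ _ _ _ He Ht Hl). }
  assert (Hb : 0 <= b) by exact (lim_ge _ _ _ _ HQ' LQ).
  assert (Hm1 : 0 < Cmod (- D, 0)) by (apply Cmod_pos; intros E; injection E; lra).
  assert (HDe : D / e <> 0).
  { apply Rmult_integral_contrapositive. split; [ lra | now apply Rinv_neq_0_compat ]. }
  assert (Hm2 : 0 < Cmod (D / e, 0)) by (apply Cmod_pos; intros E; injection E; trivial).
  assert (Llog : filterlim (fun y => e * ln (Cmod (- D, y)) + ln (Cmod (D / e, y))) (at_right 0)
      (locally (e * ln (Cmod (- D, 0)) + ln (Cmod (D / e, 0))))).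
  { apply lim_plus; trivial; [ apply lim_mult; trivial; [ apply filterlim_const | ] | ];
    (apply lim_ln; trivial; apply lim_Cmod; trivial; [ apply filterlim_const | apply lim_at_right ]). }
  assert (Larg : filterlim (fun y => e * Carg (- D, y) + Carg (D / e, y)) (at_right 0)
      (locally (e * Carg (- D, 0) + Carg (D / e, 0)))).
  { assert (Hy : at_right 0 (fun y => 0 <= y)).
    { generalize at_right_pos. apply filter_imp. intros; lra. }
    apply lim_plus; trivial; [ apply lim_mult; trivial; [ apply filterlim_const | ] | ];
    (apply lim_Carg; trivial; [ lra | apply filterlim_const | apply lim_at_right ]). }
  (* Neither factor can vanish in the limit: while the conserved logarithm stays
     bounded, both moduli stay away from 0. *)
  assert (Hbd := lim_bounded _ _ _ Llog).
  set (M := Rabs _ + 1) in Hbd.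
  assert (LPk : filterlim (fun y => P y + k) (at_right 0) (locally (a + k))).
  { apply lim_plus; trivial. apply filterlim_const. }
  assert (Ha : 0 < Cmod (a, b)).
  { destruct (away_from_zero e 1 k M He Hk) as [d [Hd Hd']].
    apply Rlt_le_trans with (1 := Hd).
    refine (lim_ge (at_right 0) (fun y => Cmod (P y, Q y)) _ _ _ (lim_Cmod _ P Q _ _ LP LQ)).
    generalize (filter_and _ _ (filter_and _ _ Hbd Hinv) HQ). apply filter_imp.
    intros y [[H1 [H2 _]] H3]. apply Hd'; trivial. rewrite Rmult_1_l, H2. exact H1. }
  assert (HB : 0 < Cmod (a + k, b)).
  { destruct (away_from_zero 1 e (- k) M ltac:(lra) ltac:(lra)) as [d [Hd Hd']].
    apply Rlt_le_trans with (1 := Hd).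
    refine (lim_ge (at_right 0) (fun y => Cmod (P y + k, Q y)) _ _ _ (lim_Cmod _ _ Q _ _ LPk LQ)).
    generalize (filter_and _ _ (filter_and _ _ Hbd Hinv) HQ). apply filter_imp.
    intros y [[H1 [H2 _]] H3]. apply Hd'; trivial.
    replace (P y + k + - k) with (P y) by ring.
    rewrite Rmult_1_l, Rplus_comm, H2. exact H1. }
  repeat split; trivial.
  - replace (ln D) with (ln (Cmod (- D, 0))).
    2: now rewrite Cmod_neg_real.
    replace (Rabs (D / e)) with (Cmod (D / e, 0)) by apply (Cmod_R (D / e)).
    apply (lim_unique (at_right 0) (fun y => e * ln (Cmod (P y, Q y)) + ln (Cmod (P y + k, Q y)))).
    + apply lim_plus; trivial; [ apply lim_mult; trivial; [ apply filterlim_const | ] | ];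
      (apply lim_ln; trivial; apply lim_Cmod; trivial).
    + apply filterlim_ext_loc with (2 := Llog). revert Hinv. apply filter_imp.
      intros y [E _]. now symmetry.
  - replace PI with (Carg (- D, 0)).
    2: now apply Carg_neg_real.
    apply (lim_unique (at_right 0) (fun y => e * Carg (P y, Q y) + Carg (P y + k, Q y))).
    + apply lim_plus; trivial; [ apply lim_mult; trivial; [ apply filterlim_const | ] | ];
      (apply lim_Carg; trivial).
    + apply filterlim_ext_loc with (2 := Larg). revert Hinv. apply filter_imp.
      intros y [_ E]. now symmetry.
Qed.

Lemma trace_equation_marginal (x0 : R) (tau : Rbar) (W x : R -> R)
    (g ginv : R -> C -> C) (gamma : R -> C) (t : R) :
  let a := Re (gamma t) - x0 in
  let b := Im (gamma t) in
  0 < x0 -> is_SLE0_rho (-2) x0 tau W x g ginv gamma -> 0 <= t -> Rbar_lt t tau ->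
  0 <= b /\ 0 < Cmod (a, b) /\
  a + x0 * ln (Cmod (a, b)) = - x0 + x0 * ln x0 + 2 * t / x0 /\
  b + x0 * Carg (a, b) = x0 * PI.
Proof.
  intros a b Hx0 H Ht Htau.
  destruct (trace_preimages _ _ _ _ _ _ _ _ t Hx0 H Ht Htau) as [P [Q [LP [LQ HPQ]]]].
  fold a b in LP, LQ, HPQ.
  assert (FF : ProperFilter (at_right 0)) by apply at_right_proper_filter.
  assert (FF' : Filter (at_right 0)) by apply filter_filter.
  assert (HQ : at_right 0 (fun y => 0 < Q y)).
  { generalize at_right_pos. apply filter_imp. intros y Hy. now destruct (HPQ y Hy) as (? & ? & ? & ? & ? & ?). }
  assert (HQ' : at_right 0 (fun y => 0 <= Q y)).
  { revert HQ. apply filter_imp. intros; lra. }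
  assert (Hinv : at_right 0 (fun y =>
    P y + x0 * ln (Cmod (P y, Q y)) = - x0 + x0 * ln (Cmod (- x0, y)) + 2 * t / x0 /\
    Q y + x0 * Carg (P y, Q y) = y + x0 * Carg (- x0, y))).
  { generalize at_right_pos. apply filter_imp. intros y Hy.
    destruct (HPQ y Hy) as (p & q & <- & <- & _ & Hl).
    replace ((-2 + 2) / 2) with 0 in Hl by field.
    exact (log_invariant_marginal _ _ _ _ _ _ Ht Hl). }
  assert (Hb : 0 <= b) by exact (lim_ge _ _ _ _ HQ' LQ).
  assert (Hm : 0 < Cmod (- x0, 0)) by (rewrite Cmod_neg_real; lra).
  assert (Hy : at_right 0 (fun y => 0 <= y)).
  { generalize at_right_pos. apply filter_imp. intros; lra. }
  assert (Llog : filterlim (fun y => - x0 + x0 * ln (Cmod (- x0, y)) + 2 * t / x0) (at_right 0)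
      (locally (- x0 + x0 * ln x0 + 2 * t / x0))).
  { rewrite <- (Cmod_neg_real x0 Hx0) at 3.
    apply lim_plus; trivial; [ apply lim_plus; trivial; [ apply filterlim_const | ] | apply filterlim_const ].
    apply lim_mult; trivial; [ apply filterlim_const | ].
    apply lim_ln; trivial; apply lim_Cmod; trivial; [ apply filterlim_const | apply lim_at_right ]. }
  assert (Larg : filterlim (fun y => y + x0 * Carg (- x0, y)) (at_right 0)
      (locally (0 + x0 * PI))).
  { rewrite <- (Carg_neg_real x0 Hx0).
    apply lim_plus; trivial; [ apply lim_at_right | ].
    apply lim_mult; trivial; [ apply filterlim_const | ].
    apply lim_Carg; trivial; [ lra | apply filterlim_const | apply lim_at_right ]. }
  assert (Ha : 0 < Cmod (a, b)).
  (* Solving the modulus equation for the modulus gives a limit of the form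
     [exp _], which is positive. *)
  { replace (Cmod (a, b)) with (exp ((- x0 + x0 * ln x0 + 2 * t / x0 - a) / x0)); [ apply exp_pos | ].
    apply (lim_unique (at_right 0) (fun y => Cmod (P y, Q y))); [ | now apply lim_Cmod ].
    apply filterlim_ext_loc with
      (fun y => exp ((- x0 + x0 * ln (Cmod (- x0, y)) + 2 * t / x0 - P y) / x0)).
    - generalize (filter_and _ _ Hinv HQ). apply filter_imp. intros y [[E _] HQy].
      rewrite <- E. rewrite <- (exp_ln (Cmod (P y, Q y))) at 2 by now apply Cmod_pos_Im.
      f_equal. field. lra.
    - apply lim_exp, lim_div; trivial; [ lra | | apply filterlim_const ].
      now apply lim_minus. }
  repeat split; trivial.
  - apply (lim_unique (at_right 0) (fun y => P y + x0 * ln (Cmod (P y, Q y)))).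
    + apply lim_plus; trivial. apply lim_mult; trivial; [ apply filterlim_const | ].
      apply lim_ln; trivial; now apply lim_Cmod.
    + apply filterlim_ext_loc with (2 := Llog). revert Hinv. apply filter_imp.
      intros y [E _]. now symmetry.
  - rewrite <- (Rplus_0_l (x0 * PI)).
    apply (lim_unique (at_right 0) (fun y => Q y + x0 * Carg (P y, Q y))).
    + apply lim_plus; trivial. apply lim_mult; trivial; [ apply filterlim_const | ].
      now apply lim_Carg.
    + apply filterlim_ext_loc with (2 := Larg). revert Hinv. apply filter_imp.
      intros y [_ E]. now symmetry.
Qed.

(** Near 0 the two conditions make both coordinates of x0 u / |u|^2 of smaller
    order than 1 / |u|, while its modulus is x0 / |u|. *)
Lemma tangential_away_from_zero (x0 M : R) : 0 < x0 -> 0 <= M -> exists delta, 0 < delta /\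
  forall p q, 0 < q ->
    Rabs (ln (Cmod (p, q)) - x0 * (p / (p * p + q * q))) <= M ->
    Carg (p, q) + x0 * (q / (p * p + q * q)) <= M -> delta <= Cmod (p, q).
Proof.
  intros Hx0 HM.
  set (K := x0 / (2 + 2 * M)).
  assert (HK : 0 < K) by (apply Rdiv_lt_0_compat; lra).
  exists (Rmin 1 (K * K)). split; [ apply Rmin_pos; nra | ].
  intros p q Hq H1 H2.
  pose proof (Cmod_pos_Im p q Hq) as Hn. pose proof (Cmod_sq p q) as Hsq.
  pose proof (proj1 (Carg_bounds p q (Rlt_le _ _ Hq))) as H3.
  rewrite <- Hsq in H1, H2. set (n := Cmod (p, q)) in *.
  destruct (Rle_lt_dec 1 n) as [H | H].
  { apply Rle_trans with (2 := H), Rmin_l. }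
  apply Rle_trans with (1 := Rmin_r _ _).
  (* With [r = sqrt n] one has [n * |ln n| <= 2 * r], so that multiplying both
     bounds by [n ^ 2] leaves an upper bound of [x0] by a multiple of [r]. *)
  set (r := sqrt n).
  assert (Hr : 0 < r) by now apply sqrt_lt_R0.
  assert (Hrn : r * r = n) by (apply sqrt_sqrt; lra).
  assert (Hr1 : r < 1) by nra.
  assert (Hlog : - ln n <= 2 / r).
  { rewrite <- Hrn, ln_mult by trivial.
    pose proof (ln_lt_self (/ r) (Rinv_0_lt_compat _ Hr)) as E. rewrite ln_Rinv in E by trivial.
    unfold Rdiv. lra. }
  assert (Hlog' : ln n < 0) by (rewrite <- ln_1; apply ln_increasing; lra).
  assert (Hq' : x0 * q <= M * (n * n)).
  { replace (x0 * q) with (x0 * (q / (n * n)) * (n * n)) by (field; lra).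
    apply Rmult_le_compat_r; nra. }
  assert (Hp' : x0 * Rabs p <= (2 / r + M) * (n * n)).
  { replace (x0 * Rabs p) with (Rabs (x0 * (p / (n * n))) * (n * n)).
    - apply Rmult_le_compat_r; [ nra | ].
      apply Rabs_le_between in H1. apply Rabs_le. lra.
    - rewrite Rabs_mult, (Rabs_pos_eq x0) by lra. unfold Rdiv at 1.
      rewrite Rabs_mult, (Rabs_pos_eq (/ (n * n))). field; lra.
      apply Rlt_le, Rinv_0_lt_compat; nra. }
  assert (Hpq : n <= Rabs p + q).
  { pose proof (Rabs_pos p). pose proof (Rsqr_abs p) as E. unfold Rsqr in E.
    apply Rsqr_incr_0_var; [ unfold Rsqr; nra | lra ]. }
  assert (Hfin : x0 <= (2 / r + M + M) * n).
  { apply Rmult_le_reg_r with n; trivial. nra. }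
  rewrite <- Hrn in Hfin |- *.
  replace ((2 / r + M + M) * (r * r)) with (r * (2 + (2 * M) * r)) in Hfin by (field; lra).
  assert (HKr : K <= r).
  { unfold K. apply Rle_div_l; [ lra | ].
    apply Rle_trans with (1 := Hfin). apply Rmult_le_compat_l; nra. }
  nra.
Qed.

Lemma trace_equation_tangential (x0 : R) (tau : Rbar) (W x : R -> R)
    (g ginv : R -> C -> C) (gamma : R -> C) (t : R) :
  let D := x t - W t in
  let a := Re (gamma t) - x0 in
  let b := Im (gamma t) in
  0 < x0 -> is_SLE0_rho (-4) x0 tau W x g ginv gamma -> 0 <= t -> Rbar_lt t tau ->
  0 <= b /\ 0 < Cmod (a, b) /\
  ln (Cmod (a, b)) - x0 * (a / (a * a + b * b)) = ln D + 1 /\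
  Carg (a, b) + x0 * (b / (a * a + b * b)) = PI.
Proof.
  intros D a b Hx0 H Ht Htau.
  destruct (trace_preimages _ _ _ _ _ _ _ _ t Hx0 H Ht Htau) as [P [Q [LP [LQ HPQ]]]].
  fold a b in LP, LQ, HPQ.
  assert (HD : 0 < D).
  { destruct (SLE0_gap_dynamics _ _ _ _ _ _ _ _ Hx0 H) as [_ [_ [_ _ Hp _]]]. now apply Hp. }
  assert (FF : ProperFilter (at_right 0)) by apply at_right_proper_filter.
  assert (FF' : Filter (at_right 0)) by apply filter_filter.
  assert (HQ : at_right 0 (fun y => 0 < Q y)).
  { generalize at_right_pos. apply filter_imp. intros y Hy. now destruct (HPQ y Hy) as (? & ? & ? & ? & ? & ?). }
  assert (HQ' : at_right 0 (fun y => 0 <= Q y)).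
  { revert HQ. apply filter_imp. intros; lra. }
  assert (Hinv : at_right 0 (fun y =>
    ln (Cmod (P y, Q y)) - x0 * (P y / (P y * P y + Q y * Q y)) =
      ln (Cmod (- D, y)) + D * (D / (D * D + y * y)) /\
    Carg (P y, Q y) + x0 * (Q y / (P y * P y + Q y * Q y)) =
      Carg (- D, y) + D * (y / (D * D + y * y)))).
  { generalize at_right_pos. apply filter_imp. intros y Hy.
    destruct (HPQ y Hy) as (p & q & <- & <- & _ & Hl).
    replace ((-4 + 2) / 2) with (-1) in Hl by field.
    exact (log_invariant_tangential _ _ _ _ _ _ Ht Hl). }
  assert (Hb : 0 <= b) by exact (lim_ge _ _ _ _ HQ' LQ).
  assert (Hm : 0 < Cmod (- D, 0)) by (rewrite Cmod_neg_real; lra).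
  assert (Hy : at_right 0 (fun y => 0 <= y)).
  { generalize at_right_pos. apply filter_imp. intros; lra. }
  assert (Ly := lim_at_right).
  assert (Lden : filterlim (fun y => D * D + y * y) (at_right 0) (locally (D * D + 0 * 0))).
  { apply lim_plus; trivial; [ apply filterlim_const | now apply lim_mult ]. }
  assert (Hden : D * D + 0 * 0 <> 0) by nra.
  assert (Llog : filterlim (fun y => ln (Cmod (- D, y)) + D * (D / (D * D + y * y))) (at_right 0)
      (locally (ln D + 1))).
  { replace (ln D + 1) with (ln (Cmod (- D, 0)) + D * (D / (D * D + 0 * 0))).
    2: { rewrite Cmod_neg_real by trivial. field. lra. }
    apply lim_plus; trivial.
    - apply lim_ln; trivial; apply lim_Cmod; trivial; apply filterlim_const.
    - apply lim_mult; trivial; [ apply filterlim_const | ].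
      apply lim_div; trivial. apply filterlim_const. }
  assert (Larg : filterlim (fun y => Carg (- D, y) + D * (y / (D * D + y * y))) (at_right 0)
      (locally PI)).
  { replace PI with (Carg (- D, 0) + D * (0 / (D * D + 0 * 0))).
    2: { rewrite Carg_neg_real by trivial. field. lra. }
    apply lim_plus; trivial.
    - apply lim_Carg; trivial; [ lra | apply filterlim_const ].
    - apply lim_mult; trivial; [ apply filterlim_const | ]. now apply lim_div. }
  assert (Ha : 0 < Cmod (a, b)).
  { assert (B1 := lim_bounded _ _ _ Llog). assert (B2 := lim_bounded _ _ _ Larg).
    set (M1 := Rabs (ln D + 1) + 1) in B1. set (M2 := Rabs PI + 1) in B2.
    assert (HM1 : 0 < M1) by (unfold M1; pose proof (Rabs_pos (ln D + 1)); lra).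
    assert (HM2 : 0 < M2) by (unfold M2; pose proof (Rabs_pos PI); lra).
    destruct (tangential_away_from_zero x0 (M1 + M2) Hx0 ltac:(lra)) as [d [Hd Hd']].
    apply Rlt_le_trans with (1 := Hd).
    refine (lim_ge (at_right 0) (fun y => Cmod (P y, Q y)) _ _ _ (lim_Cmod _ P Q _ _ LP LQ)).
    generalize (filter_and _ _ (filter_and _ _ B1 B2) (filter_and _ _ Hinv HQ)). apply filter_imp.
    intros y [[H1 H2] [[E1 E2] H3]]. apply Hd'; trivial.
    - rewrite E1. lra.
    - rewrite E2. apply Rabs_le_between in H2. lra. }
  assert (Lden' : filterlim (fun y => P y * P y + Q y * Q y) (at_right 0) (locally (a * a + b * b))).
  { apply lim_plus; trivial; now apply lim_mult. }
  assert (Hden' : a * a + b * b <> 0) by (rewrite <- Cmod_sq; nra).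
  repeat split; trivial.
  - apply (lim_unique (at_right 0)
      (fun y => ln (Cmod (P y, Q y)) - x0 * (P y / (P y * P y + Q y * Q y)))).
    + apply lim_minus; trivial.
      * apply lim_ln; trivial; now apply lim_Cmod.
      * apply lim_mult; trivial; [ apply filterlim_const | now apply lim_div ].
    + apply filterlim_ext_loc with (2 := Llog). revert Hinv. apply filter_imp.
      intros y [E _]. now symmetry.
  - apply (lim_unique (at_right 0)
      (fun y => Carg (P y, Q y) + x0 * (Q y / (P y * P y + Q y * Q y)))).
    + apply lim_plus; trivial.
      * now apply lim_Carg.
      * apply lim_mult; trivial; [ apply filterlim_const | now apply lim_div ].
    + apply filterlim_ext_loc with (2 := Larg). revert Hinv. apply filter_imp.
      intros y [_ E]. now symmetry.
Qed.

(** * The end of the lifetime *)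

Lemma Rbar_at_left_filter (tau : Rbar) : Filter (Rbar_at_left tau).
Proof. apply within_filter, filter_filter. Qed.

Lemma eventually_in_lifetime (tau : Rbar) :
  Rbar_lt 0 tau -> Rbar_at_left tau (fun t => 0 <= t /\ Rbar_lt t tau).
Proof.
  destruct tau as [T | | ]; simpl; intros H; unfold Rbar_at_left, within; simpl.
  - generalize (open_gt 0 T H). apply filter_imp. intros t Ht Ht'. simpl in *. lra.
  - exists 0. intros t Ht _. simpl; split; trivial; lra.
  - contradiction.
Qed.

Lemma gap_vanishes (e x0 : R) (D : R -> R) (K : R) :
  let tau := Finite (- (x0 ^ 2 / (4 * e))) in
  0 < x0 -> e < 0 -> gap_dynamics e x0 tau D -> Rbar_at_left tau (fun t => ln (D t) < K).
Proof.
  intros tau Hx0 He [_ _ Hp Hs].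
  set (T := - (x0 ^ 2 / (4 * e))) in *.
  assert (HT : x0 ^ 2 + 4 * e * T = 0) by (unfold T; field; lra).
  assert (HT0 : 0 < T) by nra.
  set (d := exp K * exp K / (- 4 * e)).
  assert (HK := exp_pos K).
  assert (Hd : 0 < d) by (apply Rdiv_lt_0_compat; nra).
  assert (Hnear : Rbar_at_left tau (fun t => T - d < t)).
  { unfold Rbar_at_left, within. simpl.
    assert (H : T - d < T) by lra.
    generalize (open_gt (T - d) T H). apply filter_imp. intros t Ht _. exact Ht. }
  assert (FF := Rbar_at_left_filter tau).
  generalize (filter_and _ _ Hnear (eventually_in_lifetime tau HT0)).
  apply filter_imp. intros t [H1 [H2 H3]].
  specialize (Hp t H2 H3). specialize (Hs t H2 H3).
  rewrite <- (ln_exp K). apply ln_increasing; trivial.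
  assert (Hd' : - 4 * e * d = exp K * exp K) by (unfold d; field; lra).
  assert (H4 : 0 < - 4 * e * (t - (T - d))) by (apply Rmult_lt_0_compat; lra).
  nra.
Qed.

Lemma gap_diverges (e x0 : R) (D : R -> R) (K : R) :
  0 < x0 -> 0 < e -> gap_dynamics e x0 p_infty D ->
  Rbar_at_left p_infty (fun t => K < ln (D t)).
Proof.
  intros Hx0 He [_ _ Hp Hs].
  assert (HK := exp_pos K).
  assert (Hfar : Rbar_at_left p_infty (fun t => exp K * exp K / (4 * e) < t)).
  { exists (exp K * exp K / (4 * e)). intros t Ht _. exact Ht. }
  assert (FF := Rbar_at_left_filter p_infty).
  generalize (filter_and _ _ Hfar (eventually_in_lifetime p_infty I)).
  apply filter_imp. intros t [H1 [H2 H3]].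
  specialize (Hp t H2 H3). specialize (Hs t H2 H3).
  rewrite <- (ln_exp K). apply ln_increasing; trivial.
  apply Rlt_div_l in H1; [ | lra ]. nra.
Qed.

(** * Asymptotics of the trace equation *)

Lemma lim_small_modulus {T} (F : (T -> Prop) -> Prop) {FF : Filter F} (a b : T -> R) :
  (forall eps, 0 < eps -> F (fun s => Cmod (a s, b s) < eps)) ->
  filterlim a F (locally 0) /\ filterlim b F (locally 0).
Proof.
  intros H. split; apply filterlim_locally; intros eps;
  generalize (H eps (cond_pos eps)); apply filter_imp; intros s Hs.
  - change (Rabs (a s - 0) < eps). rewrite Rminus_0_r.
    apply Rle_lt_trans with (2 := Hs), Re_le_Cmod.
  - change (Rabs (b s - 0) < eps). rewrite Rminus_0_r.
    apply Rle_lt_trans with (2 := Hs), Im_le_Cmod.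
Qed.

Lemma lim_to_real_point (F : (R -> Prop) -> Prop) {FF : Filter F} (gamma : R -> C) (p : R) :
  filterlim (fun t => Re (gamma t) - p) F (locally 0) ->
  filterlim (fun t => Im (gamma t)) F (locally 0) ->
  filterlim gamma F (locally (RtoC p)).
Proof.
  intros Hr Hi.
  apply filterlim_ext with (fun t => (Re (gamma t) - p + p, Im (gamma t))).
  { intros t. destruct (gamma t) as [u v]. simpl. f_equal. ring. }
  replace (RtoC p) with ((0 + p, 0) : C) by (unfold RtoC; f_equal; ring).
  apply lim_pair; trivial. apply lim_plus; trivial. apply filterlim_const.
Qed.

(** The equation of the trace for u = a + i b = gamma - x0, as a balance of
    logarithms and arguments; [L] stands for the logarithm of the gap. *)
Definition trace_relation (e k c1 c2 L a b : R) : Prop :=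
  0 <= b /\ 0 < Cmod (a, b) /\ 0 < Cmod (a + k, b) /\
  e * ln (Cmod (a, b)) + ln (Cmod (a + k, b)) = (e + 1) * L - c1 /\
  e * Carg (a, b) + Carg (a + k, b) = c2.

(** Both hitting cases reduce to f^alpha = C g exp ((alpha - 1) L) with
    alpha > 1, where g exceeds f by at most a constant: as L tends to minus
    infinity, f must tend to 0. *)
Lemma power_balance_vanishes {T} (F : (T -> Prop) -> Prop) {FF : Filter F}
    (alpha k c : R) (f g L : T -> R) :
  1 < alpha -> 0 <= k ->
  F (fun s => 0 < f s /\ 0 < g s <= f s + k /\
              alpha * ln (f s) = ln (g s) + (alpha - 1) * L s + c) ->
  (forall K, F (fun s => L s < K)) ->
  forall eps, 0 < eps -> F (fun s => f s < eps).
Proof.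
  intros Ha Hk Hbal HL eps Heps.
  generalize (filter_and _ _ Hbal (HL (ln eps - (ln (1 + k / eps) + c) / (alpha - 1)))).
  apply filter_imp. intros s [[Hf [Hg E]] HLs].
  (* If [eps <= f s] then [g s] is at most a constant times [f s], and the balance
     bounds [(alpha - 1) * L s] below. *)
  destruct (Rlt_le_dec (f s) eps) as [H | H]; trivial. exfalso.
  assert (Hke : 0 <= k / eps) by (apply Rmult_le_pos; [ trivial | left; now apply Rinv_0_lt_compat ]).
  assert (H1 : g s <= (1 + k / eps) * f s).
  { apply Rle_trans with (1 := proj2 Hg).
    replace k with (k / eps * eps) at 1 by (field; lra). nra. }
  assert (H2 : ln (g s) <= ln (1 + k / eps) + ln (f s)).
  { rewrite <- ln_mult by lra. apply ln_le; lra. }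
  assert (H3 : ln eps <= ln (f s)) by now apply ln_le.
  apply (Rmult_lt_compat_l (alpha - 1)) in HLs; [ | lra ].
  replace ((alpha - 1) * (ln eps - (ln (1 + k / eps) + c) / (alpha - 1)))
    with ((alpha - 1) * ln eps - (ln (1 + k / eps) + c)) in HLs by (field; lra).
  assert (H4 : (alpha - 1) * ln eps <= (alpha - 1) * ln (f s)) by (apply Rmult_le_compat_l; lra).
  lra.
Qed.

(** For e < -1 the modulus equation forces u to 0. Then u + k tends to k > 0, so
    its argument tends to 0, and the argument equation gives the limit
    (e + 1) PI / e for the argument of u. *)
Lemma asymptotics_at_force_point {T} (F : (T -> Prop) -> Prop) {FF : Filter F}
    (e k c : R) (L a b : T -> R) :
  e < -1 -> 0 < k -> F (fun t => trace_relation e k c ((e + 1) * PI) (L t) (a t) (b t)) ->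
  (forall K, F (fun t => L t < K)) ->
  filterlim a F (locally 0) /\ filterlim b F (locally 0) /\
  filterlim (fun t => Carg (a t, b t)) F (locally (PI * ((e + 1) / e))).
Proof.
  intros He Hk Hrel HL.
  destruct (lim_small_modulus F a b) as [La Lb].
  { apply (power_balance_vanishes F (- e) k c _ (fun t => Cmod (a t + k, b t)) L); trivial; try lra.
    revert Hrel. apply filter_imp. intros t (Hb & H1 & H2 & E & _).
    pose proof (Cmod_shift (a t) (b t) k) as H3. rewrite Rabs_pos_eq in H3 by lra.
    repeat split; trivial; lra. }
  split; [ | split ]; trivial.
  assert (LB : filterlim (fun t => Carg (a t + k, b t)) F (locally (Carg (0 + k, 0)))).
  { apply lim_Carg; trivial; try lra.
    - revert Hrel. apply filter_imp. intros t H. apply H.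
    - apply Cmod_pos. intros E. injection E. lra.
    - apply lim_plus; trivial. apply filterlim_const. }
  rewrite Carg_pos_real in LB by lra.
  apply filterlim_ext_loc with (fun t => ((e + 1) * PI - Carg (a t + k, b t)) / e).
  { revert Hrel. apply filter_imp. intros t (_ & _ & _ & _ & E). rewrite <- E. field. lra. }
  replace (PI * ((e + 1) / e)) with (((e + 1) * PI - 0) / e) by (field; lra).
  apply lim_div; trivial; [ lra | | apply filterlim_const ].
  apply lim_minus; trivial. apply filterlim_const.
Qed.

(** For -1 < e < 0 the roles of the two factors are exchanged: u + k tends to 0,
    so u tends to - k > 0 and its argument to 0, and the argument equation
    determines the direction of approach of u + k. *)
Lemma asymptotics_beyond_force_point {T} (F : (T -> Prop) -> Prop) {FF : Filter F}
    (e k c : R) (L a b : T -> R) :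
  -1 < e < 0 -> k < 0 -> F (fun t => trace_relation e k c ((e + 1) * PI) (L t) (a t) (b t)) ->
  (forall K, F (fun t => L t < K)) ->
  filterlim (fun t => a t + k) F (locally 0) /\ filterlim b F (locally 0) /\
  filterlim (fun t => Carg (a t + k, b t)) F (locally (PI * (e + 1))).
Proof.
  intros He Hk Hrel HL.
  destruct (lim_small_modulus F (fun t => a t + k) b) as [La Lb].
  { apply (power_balance_vanishes F (- / e) (- k) (c / e) _ (fun t => Cmod (a t, b t)) L); trivial; try lra.
    - assert (H : 1 < / - e) by (rewrite <- Rinv_1; apply Rinv_lt_contravar; lra).
      rewrite Rinv_opp in H. lra.
    - revert Hrel. apply filter_imp. intros t (Hb & H1 & H2 & E & _).
      pose proof (Cmod_shift (a t + k) (b t) (- k)) as H3. rewrite Rabs_pos_eq in H3 by lra.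
      replace (a t + k + - k) with (a t) in H3 by ring.
      repeat split; trivial.
      replace (ln (Cmod (a t + k, b t))) with ((e + 1) * L t - c - e * ln (Cmod (a t, b t))) by lra.
      field. lra. }
  split; [ | split ]; trivial.
  assert (LB : filterlim (fun t => Carg (a t, b t)) F (locally (Carg (0 - k, 0)))).
  { apply lim_Carg; trivial; try lra.
    - revert Hrel. apply filter_imp. intros t H. apply H.
    - apply Cmod_pos. intros E. injection E. lra.
    - apply filterlim_ext with (fun t => a t + k - k). intros; ring.
      apply lim_minus; trivial. apply filterlim_const. }
  rewrite Carg_pos_real in LB by lra.
  apply filterlim_ext_loc with (fun t => (e + 1) * PI - e * Carg (a t, b t)).
  { revert Hrel. apply filter_imp. intros t (_ & _ & _ & _ & E). rewrite <- E. ring. }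
  replace (PI * (e + 1)) with ((e + 1) * PI - e * 0) by ring.
  apply lim_minus; trivial. apply filterlim_const.
  apply lim_mult; trivial. apply filterlim_const.
Qed.

(** As L tends to minus infinity, u must tend to 0. The argument equation then
    says that the imaginary part of u is of order |u|^2, and the modulus equation
    that its real part is positive: the approach is tangential. *)
Lemma asymptotics_tangential {T} (F : (T -> Prop) -> Prop) {FF : Filter F}
    (x0 : R) (L a b : T -> R) :
  0 < x0 ->
  F (fun t => 0 <= b t /\ 0 < Cmod (a t, b t) /\
     ln (Cmod (a t, b t)) - x0 * (a t / (a t * a t + b t * b t)) = L t + 1 /\
     Carg (a t, b t) + x0 * (b t / (a t * a t + b t * b t)) = PI) ->
  (forall K, F (fun t => L t < K)) ->
  filterlim a F (locally 0) /\ filterlim b F (locally 0) /\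
  filterlim (fun t => Carg (a t, b t)) F (locally 0).
Proof.
  intros Hx0 Hrel HL.
  assert (Hsmall : forall eps, 0 < eps -> F (fun t => Cmod (a t, b t) < eps)).
  { intros eps Heps.
    generalize (filter_and _ _ Hrel (HL (ln eps - x0 / eps - 1))). apply filter_imp.
    intros t [(Hb & Hn & E & _) HLt].
    (* Away from 0 the left side of the modulus equation is bounded below. *)
    destruct (Rlt_le_dec (Cmod (a t, b t)) eps) as [H | H]; trivial. exfalso.
    assert (H1 : ln eps <= ln (Cmod (a t, b t))) by now apply ln_le.
    pose proof (Re_le_Cmod (a t) (b t)) as H2. apply Rabs_le_between in H2.
    rewrite <- Cmod_sq in E. set (n := Cmod (a t, b t)) in *.
    assert (H3 : a t / (n * n) <= / n).
    { apply Rle_div_l; [ nra | ]. replace (/ n * (n * n)) with n by (field; lra). lra. }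
    assert (H4 : / n <= / eps) by (apply Rinv_le_contravar; lra).
    assert (H5 : x0 * (a t / (n * n)) <= x0 / eps).
    { apply Rmult_le_compat_l; lra. }
    lra. }
  destruct (lim_small_modulus F a b Hsmall) as [La Lb].
  split; [ | split ]; trivial.
  assert (Hn0 : filterlim (fun t => Cmod (a t, b t)) F (locally 0)).
  { rewrite <- Cmod_0. change (RtoC 0) with (0, 0). now apply lim_Cmod. }
  apply lim_from_cos; trivial.
  { revert Hrel. apply filter_imp. intros t H. apply Carg_bounds, H. }
  { pose proof PI_RGT_0. lra. }
  rewrite cos_0.
  (* The argument equation bounds [sin (Carg _)] by [PI / x0] times the modulus,
     which forces the cosine to be close to 1 or to -1. *)
  set (n := fun t => Cmod (a t, b t)) in *.
  assert (Hcos : F (fun t => 1 - PI / x0 * n t * (PI / x0 * n t) <= cos (Carg (a t, b t)) <= 1)).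
  { pose proof PI_RGT_0 as Hpi.
    set (d := Rmin (x0 / (2 * PI)) (Rmin 1 (x0 / 4 * (x0 / 4)))).
    assert (Hd : 0 < d).
    { apply Rmin_pos; [ apply Rdiv_lt_0_compat; lra | apply Rmin_pos; nra ]. }
    generalize (filter_and _ _ Hrel (filter_and _ _ (Hsmall d Hd) (HL (- 1)))). apply filter_imp.
    intros t [(Hb & Hn & E1 & E2) [Hnd HLt]].
    split; [ | apply COS_bound ].
    rewrite cos_Carg by trivial.
    pose proof (Carg_bounds (a t) (b t) Hb) as Hth.
    pose proof (Cmod_sq (a t) (b t)) as Hsq. rewrite <- Hsq in E1, E2.
    pose proof (Re_le_Cmod (a t) (b t)) as Hre. apply Rabs_le_between in Hre.
    unfold n. set (m := Cmod (a t, b t)) in *.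
    assert (Hd1 : m < x0 / (2 * PI)).
    { apply Rlt_le_trans with (1 := Hnd), Rmin_l. }
    assert (Hd2 : m < 1).
    { apply Rlt_le_trans with (1 := Hnd). apply Rle_trans with (1 := Rmin_r _ _), Rmin_l. }
    assert (Hd3 : m < x0 / 4 * (x0 / 4)).
    { apply Rlt_le_trans with (1 := Hnd). apply Rle_trans with (1 := Rmin_r _ _), Rmin_r. }
    assert (Hbm : b t / m <= PI / x0 * m).
    { apply Rle_div_l; trivial. apply Rmult_le_reg_l with x0; trivial.
      replace (x0 * (PI / x0 * m * m)) with (PI * (m * m)) by (field; lra).
      replace (x0 * b t) with (x0 * (b t / (m * m)) * (m * m)) by (field; lra).
      apply Rmult_le_compat_r; nra. }
    assert (Hbm0 : 0 <= b t / m) by (apply Rmult_le_pos; [ trivial | left; now apply Rinv_0_lt_compat ]).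
    assert (Hsum : a t / m * (a t / m) = 1 - b t / m * (b t / m)).
    { apply Rmult_eq_reg_r with (m * m); [ | nra ].
      transitivity (a t * a t); [ field; lra | ].
      replace (a t * a t) with (m * m - b t * b t) by lra. field. lra. }
    assert (Hsmall' : PI / x0 * m < / 2).
    { apply Rmult_lt_reg_l with (x0 / PI); [ apply Rdiv_lt_0_compat; lra | ].
      replace (x0 / PI * (PI / x0 * m)) with m by (field; lra).
      replace (x0 / PI * / 2) with (x0 / (2 * PI)) by (field; lra). trivial. }
    assert (Ham1 : -1 <= a t / m <= 1) by (apply cos_Carg_range; trivial).
    (* A negative real part would make the left side of the modulus equation at
       least [ln m + x0 / (2 * m)], which is nonnegative for small [m], whereas
       the right side tends to minus infinity. *)
    assert (Ham : 0 < a t / m).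
    { destruct (Rlt_le_dec 0 (a t / m)) as [H | H]; trivial. exfalso.
      assert (Ha1 : a t / m <= - / 2) by nra.
      set (r := sqrt m).
      assert (Hr : 0 < r) by now apply sqrt_lt_R0.
      assert (Hrm : r * r = m) by (apply sqrt_sqrt; lra).
      assert (Hr4 : r < x0 / 4) by nra.
      assert (Hlog : - ln m <= 2 / r).
      { rewrite <- Hrm, ln_mult by trivial.
        pose proof (ln_lt_self (/ r) (Rinv_0_lt_compat _ Hr)) as E. rewrite ln_Rinv in E by trivial.
        unfold Rdiv. lra. }
      assert (Hx : x0 * (a t / (m * m)) <= - (2 / r)).
      { replace (a t / (m * m)) with (a t / m * / m) by (field; lra).
        assert (Him : 0 < / m) by now apply Rinv_0_lt_compat.
        apply Rle_trans with (x0 * (- / 2 * / m)).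
        - apply Rmult_le_compat_l; [ lra | ]. apply Rmult_le_compat_r; lra.
        - rewrite <- Hrm. apply Rmult_le_reg_r with (r * r); [ nra | ].
          replace (x0 * (- / 2 * / (r * r)) * (r * r)) with (- x0 / 2) by (field; lra).
          replace (- (2 / r) * (r * r)) with (- 2 * r) by (field; lra). lra. }
      lra. }
    assert (H : b t / m * (b t / m) <= PI / x0 * m * (PI / x0 * m)) by (apply Rmult_le_compat; trivial).
    nra. }
  assert (Llow : filterlim (fun t => 1 - PI / x0 * n t * (PI / x0 * n t)) F (locally 1)).
  { enough (Hl : filterlim (fun t => 1 - PI / x0 * n t * (PI / x0 * n t)) F
      (locally (1 - PI / x0 * 0 * (PI / x0 * 0)))).
    { now replace (1 - PI / x0 * 0 * (PI / x0 * 0)) with 1 in Hl by ring. }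
    apply lim_minus; trivial; [ apply filterlim_const | ].
    apply lim_mult; trivial; (apply lim_mult; trivial; apply filterlim_const). }
  exact (filterlim_le_le _ _ _ 1 Hcos Llow (filterlim_const 1)).
Qed.

(** For e > 0 the modulus of u tends to infinity, so the arguments of u, u + d and
    u + k become equal and the argument equation gives (e + 1) theta = e PI in the
    limit. The shift by [d] accounts for the difference between gamma and
    gamma - x0. *)
Lemma asymptotics_at_infinity {T} (F : (T -> Prop) -> Prop) {FF : Filter F}
    (e k c d : R) (L a b : T -> R) :
  0 < e -> 0 < d <= k -> F (fun t => trace_relation e k c (e * PI) (L t) (a t) (b t)) ->
  (forall K, F (fun t => K < L t)) ->
  (forall M, F (fun t => M < Cmod (a t + d, b t))) /\
  filterlim (fun t => Carg (a t + d, b t)) F (locally (PI * (e / (e + 1)))).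
Proof.
  intros He Hd Hrel HL. assert (Hpi := PI_RGT_0).
  assert (Hbig : forall M, 0 < M -> F (fun t => M < Cmod (a t, b t))).
  { intros M HM.
    generalize (filter_and _ _ Hrel (HL ((e * ln M + ln (M + k) + c) / (e + 1)))). apply filter_imp.
    intros t [(Hb & Hn & HB & E & _) HLt].
    destruct (Rlt_le_dec M (Cmod (a t, b t))) as [H | H]; trivial. exfalso.
    pose proof (Cmod_shift (a t) (b t) k) as H3. rewrite Rabs_pos_eq in H3 by lra.
    assert (H1 : ln (Cmod (a t, b t)) <= ln M) by now apply ln_le.
    assert (H2 : ln (Cmod (a t + k, b t)) <= ln (M + k)) by (apply ln_le; lra).
    apply Rlt_div_l in HLt; [ | lra ]. nra. }
  (* [l] is the common value forced by [e * theta + beta = e * PI] when the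
     arguments theta of [a] and beta of [a + k] agree; since beta <= theta always,
     they lie on either side of [l]. *)
  set (l := PI * (e / (e + 1))).
  assert (Hl : (e + 1) * l = e * PI) by (unfold l; field; lra).
  assert (Hl' : 0 <= l <= PI) by nra.
  assert (Hlow : forall t, Cmod (a t, b t) - d <= Cmod (a t + d, b t)).
  { intros t. pose proof (Cmod_shift (a t + d) (b t) (- d)) as H.
    rewrite Rabs_Ropp, Rabs_pos_eq in H by lra.
    replace (a t + d + - d) with (a t) in H by ring. lra. }
  assert (Hlowk : forall t, Cmod (a t, b t) - k <= Cmod (a t + k, b t)).
  { intros t. pose proof (Cmod_shift (a t + k) (b t) (- k)) as H.
    rewrite Rabs_Ropp, Rabs_pos_eq in H by lra.
    replace (a t + k + - k) with (a t) in H by ring. lra. }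
  assert (Ltheta : filterlim (fun t => Carg (a t, b t)) F (locally l)).
  { apply lim_from_cos; trivial.
    { revert Hrel. apply filter_imp. intros t H. apply Carg_bounds, H. }
    apply filterlim_locally. intros eps.
    generalize (filter_and _ _ Hrel (Hbig (2 * k / eps + k) ltac:(assert (0 < 2 * k / eps) by
      (apply Rdiv_lt_0_compat; [ lra | apply cond_pos ]); lra))).
    apply filter_imp. intros t [(Hb & Hn & HB & _ & E) Ht].
    change (Rabs (cos (Carg (a t, b t)) - cos l) < eps).
    assert (Hsh := Carg_shift (a t) (b t) k Hb ltac:(lra) Hn HB).
    pose proof (Carg_bounds (a t) (b t) Hb) as B1.
    pose proof (Carg_bounds (a t + k) (b t) Hb) as B2.
    assert (C1 : cos (Carg (a t, b t)) <= cos l) by (apply cos_decr_1; nra).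
    assert (C2 : cos l <= cos (Carg (a t + k, b t))) by (apply cos_decr_1; nra).
    rewrite Rabs_left1 by lra.
    enough (cos (Carg (a t + k, b t)) - cos (Carg (a t, b t)) < eps) by lra.
    rewrite !cos_Carg by trivial.
    specialize (Hlowk t).
    pose proof (Re_le_Cmod (a t) (b t)) as Hre. apply Rabs_le_between in Hre.
    pose proof (Cmod_shift (a t) (b t) k) as Hup. rewrite Rabs_pos_eq in Hup by lra.
    set (n := Cmod (a t, b t)) in *. set (m := Cmod (a t + k, b t)) in *.
    apply Rle_lt_trans with (2 * k / m).
    - apply Rmult_le_reg_r with (m * n). nra.
      replace (((a t + k) / m - a t / n) * (m * n)) with (k * n + a t * (n - m)) by (field; lra).
      replace (2 * k / m * (m * n)) with (2 * k * n) by (field; lra).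
      enough (a t * (n - m) <= k * n) by lra.
      apply Rle_trans with (Rabs (a t * (n - m))); [ apply Rle_abs | ].
      rewrite Rabs_mult, (Rmult_comm k). apply Rmult_le_compat; try apply Rabs_pos.
      + apply Re_le_Cmod.
      + apply Rabs_le. lra.
    - apply Rlt_div_l; trivial.
      assert (Ht' : 2 * k / eps < m) by lra.
      apply Rlt_div_l in Ht'; [ lra | apply cond_pos ]. }
  split.
  - intros M. assert (HM : 0 < Rabs M + 1 + d) by (pose proof (Rabs_pos M); lra).
    generalize (Hbig _ HM). apply filter_imp. intros t Ht. specialize (Hlow t).
    pose proof (Rle_abs M). lra.
  - apply (filterlim_le_le (F := F) (fun t => e * PI - e * Carg (a t, b t)) _
      (fun t => Carg (a t, b t)) l); trivial.
    + generalize (filter_and _ _ Hrel (Hbig k ltac:(lra))). apply filter_imp.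
      intros t [(Hb & Hn & HB & _ & E) Ht]. specialize (Hlow t).
      assert (Hd0 : 0 < Cmod (a t + d, b t)) by lra. split.
      * replace (e * PI - e * Carg (a t, b t)) with (Carg (a t + k, b t)) by lra.
        replace (a t + k) with (a t + d + (k - d)) by ring.
        apply Carg_shift; trivial; try lra.
        replace (a t + d + (k - d)) with (a t + k) by ring. trivial.
      * apply Carg_shift; trivial; lra.
    + replace l with (e * PI - e * l) at 1 by lra.
      apply (lim_minus F (fun _ => e * PI) (fun t => e * Carg (a t, b t))); [ apply filterlim_const | ].
      apply (lim_mult F (fun _ => e)); trivial. apply filterlim_const.
Qed.

(** The imaginary part of u is at most x0 PI, so the growth of L forces the real
    part to infinity; hence the argument tends to 0 and the imaginary part to
    x0 PI. *)
Lemma asymptotics_marginal {T} (F : (T -> Prop) -> Prop) {FF : Filter F}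
    (x0 : R) (L a b : T -> R) :
  0 < x0 ->
  F (fun t => 0 <= b t /\ 0 < Cmod (a t, b t) /\
     a t + x0 * ln (Cmod (a t, b t)) = L t /\ b t + x0 * Carg (a t, b t) = x0 * PI) ->
  (forall K, F (fun t => K < L t)) ->
  (forall M, F (fun t => M < a t)) /\ filterlim b F (locally (PI * x0)).
Proof.
  intros Hx0 Hrel HL. assert (Hpi := PI_RGT_0).
  assert (Hbig : forall M, F (fun t => M < a t)).
  { intros M. set (M' := Rabs M).
    assert (HM' : 0 <= M') by apply Rabs_pos.
    generalize (filter_and _ _ Hrel (HL (2 * M' + x0 * PI + x0 * ln x0))). apply filter_imp.
    intros t [(Hb & Hn & E1 & E2) HLt].
    pose proof (proj1 (Carg_bounds (a t) (b t) Hb)) as Hth.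
    pose proof (Cmod_le_sum (a t) (b t)) as Hs. rewrite (Rabs_pos_eq (b t)) in Hs by trivial.
    assert (Hlog : x0 * ln (Cmod (a t, b t)) <= Cmod (a t, b t) + x0 * ln x0).
    { pose proof (ln_lt_self (Cmod (a t, b t) / x0) ltac:(apply Rdiv_lt_0_compat; trivial)) as H.
      rewrite ln_div in H by trivial.
      apply (Rmult_lt_compat_l x0) in H; trivial.
      replace (x0 * (Cmod (a t, b t) / x0)) with (Cmod (a t, b t)) in H by (field; lra). lra. }
    assert (Hx : 0 <= x0 * Carg (a t, b t)) by (apply Rmult_le_pos; lra).
    apply Rle_lt_trans with (1 := Rle_abs M). fold M'.
    unfold Rabs in Hs. destruct (Rcase_abs (a t)); lra. }
  split; trivial.
  assert (Lth : filterlim (fun t => Carg (a t, b t)) F (locally 0)).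
  { apply lim_from_cos; trivial; [ | lra | ].
    { revert Hrel. apply filter_imp. intros t H. apply Carg_bounds, H. }
    rewrite cos_0. apply filterlim_locally. intros eps.
    generalize (filter_and _ _ Hrel (filter_and _ _ (Hbig (x0 * PI / eps)) (Hbig 0))).
    apply filter_imp. intros t [(Hb & Hn & _ & E2) [H1 H2]].
    change (Rabs (cos (Carg (a t, b t)) - 1) < eps).
    rewrite cos_Carg by trivial. pose proof (cos_Carg_range _ _ Hn).
    pose proof (Re_le_Cmod (a t) (b t)) as Hre. apply Rabs_le_between in Hre.
    rewrite Rabs_left1 by lra.
    pose proof (Cmod_le_sum (a t) (b t)) as Hs. rewrite !Rabs_pos_eq in Hs by lra.
    set (n := Cmod (a t, b t)) in *.
    pose proof (proj1 (Carg_bounds (a t) (b t) Hb)) as Hth.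
    assert (Hx : 0 <= x0 * Carg (a t, b t)) by (apply Rmult_le_pos; lra).
    apply Rlt_div_l in H1; [ | apply cond_pos ].
    apply Rmult_lt_reg_r with n; trivial.
    replace (- (a t / n - 1) * n) with (n - a t) by (field; lra).
    pose proof (cond_pos eps).
    apply Rle_lt_trans with (x0 * PI); [ lra | ]. apply Rlt_le_trans with (1 := H1). nra. }
  apply filterlim_ext_loc with (fun t => x0 * PI - x0 * Carg (a t, b t)).
  { revert Hrel. apply filter_imp. intros t (_ & _ & _ & E). lra. }
  replace (PI * x0) with (x0 * PI - x0 * 0) by ring.
  apply lim_minus; trivial; [ apply filterlim_const | ].
  apply lim_mult; trivial. apply filterlim_const.
Qed.

(** * Rays avoiding the curve *)

Lemma segment_connected (c : R -> C) (U V : C -> Prop) (l1 l2 : R) :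
  l1 <= l2 -> open U -> open V ->
  (forall l, l1 <= l <= l2 -> filterlim c (locally l) (locally (c l))) ->
  (forall l, l1 <= l <= l2 -> U (c l) \/ V (c l)) -> U (c l1) -> V (c l2) ->
  exists l, l1 <= l <= l2 /\ U (c l) /\ V (c l).
Proof.
  intros Hl HU HV Hc Hcov H1 H2.
  destruct (completeness (fun l => l1 <= l <= l2 /\ U (c l))) as [s [Hub Hlub]].
  { exists l2. intros l Hl'. lra. }
  { exists l1. split; trivial; lra. }
  assert (Hs1 : l1 <= s) by (apply Hub; split; trivial; lra).
  assert (Hs2 : s <= l2) by (apply Hlub; intros l Hl'; lra).
  assert (Hball : forall P : C -> Prop, open P -> P (c s) ->
    exists d, 0 < d /\ forall l, Rabs (l - s) < d -> P (c l)).
  { intros P HP HPs. destruct (Hc s ltac:(lra) _ (HP _ HPs)) as [d Hd].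
    exists d. split; [ apply cond_pos | exact Hd ]. }
  (* [s] is the supremum of the parameters whose point lies in [U]: just after
     [s] the curve is out of [U], yet points of [U] accumulate at [s]. *)
  destruct (Hcov s ltac:(lra)) as [Hs | Hs].
  - destruct (Hball U HU Hs) as [d [Hd HdU]].
    exists l2. split; [ lra | split; trivial ].
    destruct (Rle_lt_dec l2 (s + d / 2)) as [H | H].
    + apply HdU. rewrite Rabs_pos_eq; lra.
    + exfalso. enough (s + d / 2 <= s) by lra. apply Hub. split; [ lra | ].
      apply HdU. rewrite Rabs_pos_eq; lra.
  - destruct (Hball V HV Hs) as [d [Hd HdV]].
    apply Classical_Prop.NNPP. intros Hno.
    enough (s <= s - d) by lra. apply Hlub. intros l [Hl' HUl].
    apply Rnot_lt_le. intros Hlt. apply Hno. exists l. split; [ trivial | split; trivial ].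
    assert (l <= s) by (apply Hub; now split).
    apply HdV. rewrite Rabs_left1; lra.
Qed.

Lemma ray_in_unbounded_component (A : C -> Prop) (p phi : R) :
  0 < phi < PI -> (forall l, 0 < l -> A (p + l * cos phi, l * sin phi)) ->
  forall l, 0 < l -> in_unbounded_component A (p + l * cos phi, l * sin phi).
Proof.
  intros Hphi HA l0 Hl0. assert (Hs := sin_gt_0 phi (proj1 Hphi) (proj2 Hphi)).
  set (c := fun l : R => (p + l * cos phi, l * sin phi) : C).
  (* The connected unbounded set is the open ray itself. *)
  exists (fun w => exists l, 0 < l /\ w = c l). repeat split.
  - assert (Hc : forall l, filterlim c (locally l) (locally (c l))).
    { intros l. assert (FF : Filter (locally l)) by apply filter_filter.
      apply lim_pair; trivial.
      - apply lim_plus; trivial; [ apply filterlim_const | ].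
        apply lim_mult; trivial; [ apply filterlim_id | apply filterlim_const ].
      - apply lim_mult; trivial; [ apply filterlim_id | apply filterlim_const ]. }
    assert (Hcon : forall U V : C -> Prop, open U -> open V ->
      (forall l, 0 < l -> U (c l) \/ V (c l)) ->
      forall l1 l2, 0 < l1 -> l1 <= l2 -> U (c l1) -> V (c l2) ->
      exists l, 0 < l /\ U (c l) /\ V (c l)).
    { intros U V HU HV Hcov l1 l2 Hl1 Hl12 H1 H2.
      destruct (segment_connected c U V l1 l2) as [l [Hl [H3 H4]]]; trivial.
      - intros l Hl. apply Hcov. lra.
      - exists l. repeat split; trivial; lra. }
    intros U V HU HV Hcov [z1 [[l1 [Hl1 ->]] H1]] [z2 [[l2 [Hl2 ->]] H2]].
    assert (Hcov' : forall l, 0 < l -> U (c l) \/ V (c l)).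
    { intros l Hl. apply Hcov. now exists l. }
    destruct (Rle_lt_dec l1 l2) as [H | H].
    + destruct (Hcon U V HU HV Hcov' l1 l2) as [l [Hl HUV]]; trivial.
      exists (c l). split; [ now exists l | trivial ].
    + destruct (Hcon V U HV HU) with (l1 := l2) (l2 := l1) as [l [Hl [HVl HUl]]]; trivial; try lra.
      { intros l Hl. destruct (Hcov' l Hl); tauto. }
      exists (c l). split; [ now exists l | split; trivial ].
  - intros w [l [Hl ->]]. now apply HA.
  - now exists l0.
  - intros M. exists (c ((Rabs M + 1) / sin phi)).
    pose proof (Rabs_pos M). pose proof (Rle_abs M). split.
    + exists ((Rabs M + 1) / sin phi). split; trivial. apply Rdiv_lt_0_compat; lra.
    + apply Rlt_le_trans with (Rabs M + 1); [ lra | ].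
      unfold c. apply Rle_trans with (2 := Im_le_Cmod _ _).
      replace ((Rabs M + 1) / sin phi * sin phi) with (Rabs M + 1) by (field; lra).
      apply Rle_abs.
Qed.

Lemma C_minus_real (z : C) (p : R) : (z - p)%C = (Re z - p, Im z).
Proof. destruct z as [u v]. unfold Cminus, Cplus, Copp, RtoC; simpl. f_equal. ring. Qed.

Lemma C_polar_point (p s phi : R) :
  (p + s * (cos phi + Ci * sin phi))%C = (p + s * cos phi, s * sin phi).
Proof. unfold Ci, Cplus, Cmult, RtoC; simpl. f_equal; ring. Qed.

(** It suffices that each ray from p within the angle misses the curve entirely,
    for the ray itself is then a connected unbounded set joining its points near
    p to infinity. *)
Lemma outer_hitting_angle_of_rays (tau : Rbar) (gamma : R -> C) (p theta : R) :
  theta < PI ->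
  filterlim (fun t => Carg (Re (gamma t) - p, Im (gamma t))) (Rbar_at_left tau) (locally theta) ->
  (forall t phi l, 0 <= t -> Rbar_lt t tau -> 0 < phi < theta -> 0 < l ->
     gamma t <> (p + l * cos phi, l * sin phi)) ->
  outer_hitting_angle tau gamma p theta.
Proof.
  intros Hth Hlim Havoid. split.
  - apply filterlim_ext with (2 := Hlim). intros t. now rewrite C_minus_real.
  - intros eps Heps. exists 1. split; [ lra | ].
    intros s phi Hs Hphi. rewrite C_polar_point.
    apply ray_in_unbounded_component; try lra.
    intros l Hl. split.
    + simpl. apply Rmult_lt_0_compat; trivial. apply sin_gt_0; lra.
    + intros (t & Ht & Htau & E). apply (Havoid t phi l); trivial; lra.
Qed.

(** * Hitting points, hitting angles and asymptotic directions *)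

Theorem corollary2 (rho x0 : R) (tau : Rbar) (W x : R -> R)
    (g ginv : R -> C -> C) (gamma : R -> C)
    (hx0 : 0 < x0) (hgamma : is_SLE0_rho rho x0 tau W x g ginv gamma) :
  (rho <= -4 ->
     filterlim gamma (Rbar_at_left tau) (locally (RtoC x0)) /\
     outer_hitting_angle tau gamma x0 (PI * ((4 + rho) / (2 + rho))) /\
     tau = Finite (- (x0 ^ 2 / (2 * (2 + rho))))) /\
  (-4 < rho < -2 ->
     filterlim gamma (Rbar_at_left tau) (locally (RtoC (- (2 / (rho + 2)) * x0))) /\
     - (2 / (rho + 2)) * x0 > x0 /\
     outer_hitting_angle tau gamma (- (2 / (rho + 2)) * x0) (PI * ((4 + rho) / 2)) /\
     tau = Finite (- (x0 ^ 2 / (2 * (2 + rho))))) /\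
  (rho = -2 ->
     approaches_infinity_asymptotic_to tau gamma
       (fun z : C => exists r : R, 0 < r /\ z = (r + Ci * (PI * x0)%R)%C)) /\
  (-2 < rho ->
     approaches_infinity_at_angle tau gamma (PI * ((2 + rho) / (4 + rho)))).
Proof.
  assert (Hpi := PI_RGT_0).
  destruct (SLE0_gap_dynamics _ _ _ _ _ _ _ _ hx0 hgamma) as [_ [_ Hgap]].
  destruct (SLE0_lifetime _ _ _ _ _ hx0 Hgap (sle_lifetime _ _ _ _ _ _ _ _ hgamma))
    as [Hinf Hfin].
  set (e := (rho + 2) / 2) in *.
  set (k := (1 + / e) * x0).
  assert (FF := Rbar_at_left_filter tau).
  (* The term PI for negative [e] is the argument of the negative number [D / e]. *)
  assert (Hrel : e <> 0 -> e <> -1 -> forall t, 0 <= t -> Rbar_lt t tau ->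
    trace_relation e k (ln (Rabs e)) (e * PI + (if Rlt_dec e 0 then PI else 0))
      (ln (x t - W t)) (Re (gamma t) - x0) (Im (gamma t))).
  { intros He He' t Ht Htau.
    assert (HD := gap_pos _ _ _ _ Hgap t Ht Htau). cbv beta in HD.
    destruct (trace_equation _ _ _ _ _ _ _ _ t hx0 hgamma Ht Htau He He') as (H1 & H2 & H3 & H4 & H5).
    fold e k in H2, H3, H4, H5. repeat split; trivial.
    - rewrite H4. unfold Rdiv. rewrite Rabs_mult, Rabs_inv, (Rabs_pos_eq (x t - W t)) by lra.
      rewrite ln_mult, ln_Rinv; trivial; try lra. now apply Rabs_pos_lt.
      apply Rinv_0_lt_compat. now apply Rabs_pos_lt.
    - rewrite H5. f_equal. destruct Rlt_dec as [Hneg | Hneg].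
      + replace ((x t - W t) / e) with (- ((x t - W t) / - e)) by (field; trivial).
        apply Carg_neg_real. apply Rdiv_lt_0_compat; lra.
      + apply Carg_pos_real. apply Rdiv_lt_0_compat; lra. }
  assert (Hshrink : e < 0 -> forall K, Rbar_at_left tau (fun t => ln (x t - W t) < K)).
  { intros He K. rewrite (Hfin He) in Hgap |- *. exact (gap_vanishes e x0 _ K hx0 He Hgap). }
  assert (Hlife : e < 0 -> Rbar_lt 0 tau).
  { intros He. rewrite (Hfin He). change (0 < - (x0 ^ 2 / (4 * e))).
    replace (- (x0 ^ 2 / (4 * e))) with (x0 ^ 2 / (- 4 * e)) by (field; lra).
    apply Rdiv_lt_0_compat; nra. }
  assert (Htau : e < 0 -> tau = Finite (- (x0 ^ 2 / (2 * (2 + rho))))).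
  { intros He. rewrite (Hfin He). f_equal. unfold e. field. unfold e in He. lra. }
  split; [ | split; [ | split ] ]; intros Hrho.
  - assert (He : e <= -1) by (unfold e; lra).
    destruct (Rle_lt_or_eq_dec _ _ He) as [He1 | He1].
    + destruct (asymptotics_at_force_point (Rbar_at_left tau) e k (ln (Rabs e))
        (fun t => ln (x t - W t)) (fun t => Re (gamma t) - x0) (fun t => Im (gamma t)))
        as (La & Lb & Lth); trivial.
      * unfold k. apply Rmult_lt_0_compat; trivial.
        replace (1 + / e) with ((- e - 1) / - e) by (field; lra). apply Rdiv_lt_0_compat; lra.
      * generalize (eventually_in_lifetime tau (Hlife ltac:(lra))). apply filter_imp.
        intros t [Ht Ht']. specialize (Hrel ltac:(lra) ltac:(lra) t Ht Ht').
        destruct Rlt_dec; [ | lra ]. replace ((e + 1) * PI) with (e * PI + PI) by ring. exact Hrel.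
      * apply Hshrink; lra.
      * split; [ now apply lim_to_real_point | split; [ | apply Htau; lra ] ].
        replace ((4 + rho) / (2 + rho)) with ((e + 1) / e) by (unfold e; field; lra).
        assert (Hratio : (e + 1) / e < 1).
        { replace ((e + 1) / e) with (1 - / - e) by (field; lra).
          assert (0 < / - e) by (apply Rinv_0_lt_compat; lra). lra. }
        apply outer_hitting_angle_of_rays; trivial; [ nra | ].
        intros t phi l Ht Ht' Hphi Hl E.
        (* On the ray from [x0] the argument of [gamma - x0] is [phi], too small for
           the argument equation since the other argument is nonnegative. *)
        destruct (Hrel ltac:(lra) ltac:(lra) t Ht Ht') as (Hb & _ & _ & _ & Harg).
        destruct Rlt_dec; [ | lra ].
        rewrite E in Harg, Hb. simpl in Harg, Hb.
        replace (x0 + l * cos phi - x0) with (l * cos phi) in Harg by ring.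
        rewrite Carg_polar in Harg by nra.
        pose proof (proj1 (Carg_bounds (l * cos phi + k) _ Hb)) as H0.
        assert (H1 : - e * phi < - e * (PI * ((e + 1) / e))) by (apply Rmult_lt_compat_l; lra).
        replace (- e * (PI * ((e + 1) / e))) with (- (e + 1) * PI) in H1 by (field; lra). lra.
    + assert (Hrho4 : rho = -4) by (unfold e in He1; lra).
      destruct (asymptotics_tangential (Rbar_at_left tau) x0
        (fun t => ln (x t - W t)) (fun t => Re (gamma t) - x0) (fun t => Im (gamma t)))
        as (La & Lb & Lth); trivial.
      * generalize (eventually_in_lifetime tau (Hlife ltac:(lra))). apply filter_imp.
        intros t [Ht Ht']. rewrite Hrho4 in hgamma.
        exact (trace_equation_tangential _ _ _ _ _ _ _ t hx0 hgamma Ht Ht').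
      * apply Hshrink; lra.
      * split; [ now apply lim_to_real_point | split; [ | apply Htau; lra ] ].
        replace (PI * ((4 + rho) / (2 + rho))) with 0 by (rewrite Hrho4; field).
        apply outer_hitting_angle_of_rays; trivial.
        (* The angle is 0, so there is no ray to check. *)
        intros; lra.
  - assert (He : -1 < e < 0) by (unfold e; lra).
    assert (Hk : k < 0).
    { unfold k. replace ((1 + / e) * x0) with (- ((e + 1) * x0 / - e)) by (field; lra).
      apply Ropp_lt_gt_0_contravar, Rdiv_lt_0_compat; nra. }
    assert (Hp : - (2 / (rho + 2)) * x0 = x0 - k) by (unfold k, e; field; lra).
    rewrite Hp.
    assert (Ha : forall t, Re (gamma t) - x0 + k = Re (gamma t) - (x0 - k)) by (intros; ring).
    destruct (asymptotics_beyond_force_point (Rbar_at_left tau) e k (ln (Rabs e))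
      (fun t => ln (x t - W t)) (fun t => Re (gamma t) - x0) (fun t => Im (gamma t)))
      as (La & Lb & Lth); trivial.
    + generalize (eventually_in_lifetime tau (Hlife ltac:(lra))). apply filter_imp.
      intros t [Ht Ht']. specialize (Hrel ltac:(lra) ltac:(lra) t Ht Ht').
      destruct Rlt_dec; [ | lra ]. replace ((e + 1) * PI) with (e * PI + PI) by ring. exact Hrel.
    + apply Hshrink; lra.
    + split; [ | split; [ lra | split; [ | apply Htau; lra ] ] ].
      * apply lim_to_real_point; trivial.
        apply filterlim_ext with (2 := La). intros t. apply Ha.
      * replace ((4 + rho) / 2) with (e + 1) by (unfold e; field).
        apply outer_hitting_angle_of_rays.
        -- nra.
        -- apply filterlim_ext with (2 := Lth). intros t. now rewrite Ha.
        -- intros t phi l Ht Ht' Hphi Hl E.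
           (* Here the ray starts at the other marked point [x0 - k], and it is the
              argument of [gamma - (x0 - k)] that is [phi]. *)
           destruct (Hrel ltac:(lra) ltac:(lra) t Ht Ht') as (Hb & _ & _ & _ & Harg).
           destruct Rlt_dec; [ | lra ].
           rewrite E in Harg, Hb. simpl in Harg, Hb.
           replace (x0 - k + l * cos phi - x0 + k) with (l * cos phi) in Harg by ring.
           rewrite Carg_polar in Harg by nra.
           pose proof (proj1 (Carg_bounds (x0 - k + l * cos phi - x0) _ Hb)) as H0. nra.
  - assert (He : e = 0) by (unfold e; lra).
    rewrite (Hinf ltac:(lra)) in *.
    destruct (asymptotics_marginal (Rbar_at_left p_infty) x0
      (fun t => - x0 + x0 * ln x0 + 2 * t / x0)
      (fun t => Re (gamma t) - x0) (fun t => Im (gamma t))) as [La Lb]; trivial.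
    + generalize (eventually_in_lifetime p_infty I). apply filter_imp.
      intros t [Ht Ht']. rewrite Hrho in hgamma.
      exact (trace_equation_marginal _ _ _ _ _ _ _ t hx0 hgamma Ht Ht').
    + intros K. exists ((K + x0 - x0 * ln x0) * x0 / 2). intros t Ht _.
      apply (Rmult_lt_reg_r (x0 / 2)); [ lra | ].
      replace ((- x0 + x0 * ln x0 + 2 * t / x0) * (x0 / 2))
        with ((- x0 + x0 * ln x0) * x0 / 2 + t) by (field; lra). lra.
    + split.
      * intros P [M HM]. unfold filtermap. generalize (La M). apply filter_imp. intros t Ht. apply HM.
        pose proof (Re_le_Cmod (Re (gamma t)) (Im (gamma t))) as H.
        pose proof (Rle_abs (Re (gamma t))). rewrite (surjective_pairing (gamma t)).
        unfold Re, Im in *. lra.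
      * intros eps Heps.
        generalize (filter_and _ _ (La 0)
          (proj1 (filterlim_locally _ _) Lb (mkposreal eps Heps))). apply filter_imp.
        intros t [Ht Hball]. change (Rabs (Im (gamma t) - PI * x0) < eps) in Hball.
        exists ((Re (gamma t), PI * x0) : C). split.
        -- exists (Re (gamma t)). split; [ lra | ].
           unfold Ci, Cplus, Cmult, RtoC; simpl. f_equal; ring.
        -- replace (gamma t - ((Re (gamma t), (PI * x0)%R) : C))%C with (0, Im (gamma t) - PI * x0).
           ++ apply Rle_lt_trans with (1 := Cmod_le_sum _ _). rewrite Rabs_R0. lra.
           ++ destruct (gamma t) as [u v]. unfold Cminus, Cplus, Copp; simpl. f_equal; ring.
  - assert (He : 0 < e) by (unfold e; lra).
    rewrite (Hinf ltac:(lra)) in *.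
    assert (Hk : x0 <= k).
    { unfold k. assert (0 < / e) by now apply Rinv_0_lt_compat. nra. }
    destruct (asymptotics_at_infinity (Rbar_at_left p_infty) e k (ln (Rabs e)) x0
      (fun t => ln (x t - W t)) (fun t => Re (gamma t) - x0) (fun t => Im (gamma t)))
      as [Lm Lth]; trivial.
    + lra.
    + generalize (eventually_in_lifetime p_infty I). apply filter_imp.
      intros t [Ht Ht']. specialize (Hrel ltac:(lra) ltac:(lra) t Ht Ht').
      destruct Rlt_dec; [ lra | ]. rewrite Rplus_0_r in Hrel. exact Hrel.
    + intros K. exact (gap_diverges e x0 _ K hx0 He Hgap).
    + assert (Hz : forall t, (Re (gamma t) - x0 + x0, Im (gamma t)) = gamma t).
      { intros t. destruct (gamma t) as [u v]. simpl. f_equal. ring. }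
      split.
      * intros P [M HM]. unfold filtermap. generalize (Lm M). apply filter_imp. intros t Ht. apply HM.
        now rewrite Hz in Ht.
      * replace ((2 + rho) / (4 + rho)) with (e / (e + 1)) by (unfold e; field; lra).
        apply filterlim_ext with (2 := Lth). intros t. now rewrite Hz.
Qed.
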